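(* Let $R$ be a subdirectly irreducible $*$-regular ring (with or without unit). If the (sectional) modular ortholattice $\overline{L}(R_R)$ of principal right ideals of $R$ has a faithful representation, then the $*$-regular ring $R$ has a faithful linear representation.
   Context: Rings are associative and need not have a unit. An involution on a ring is an anti-automorphism $x\mapsto x^*$ with $(x^* )^*=x$. A $*$-regular ring is a ring $R$ with involution such that for every $x$ there is $y$ with $xyx=x$, and such that $xx^*=0$ implies $x=0$. A $*$-regular ring is subdirectly irreducible if it has a smallest nonzero two-sided ideal (two-sided ideals of $*$-regular rings are automatically closed under $^*$). $\overline{L}(R_R)$ denotes the set of principal right ideals $aR$, $a\in R$, ordered by inclusion. For a $*$-regular ring with unit it is a modular ortholattice (MOL): each principal right ideal is $eR$ for a unique projection $e$ ($e^2=e^*=e$), orthogonality is $aR\perp bR \Leftrightarrow b^*a=0$, and $(eR)^\perp=(1-e)R$. Without unit it is a sectional MOL: a modular lattice with $0$ in which each section $[0,b]$ is a MOL with orthocomplementation $x\mapsto x^{\prime_b}$; for projections $e,f$ with $eR\subseteq fR$, the orthocomplement of $eR$ in $[0,fR]$ is $(f-e)R$. A scalar product on a right vector space $V_D$ over a skew field $D$ with involution is an anisotropic Hermitian sesquilinear form $\langle\cdot,\cdot\rangle$. A linear representation of a $*$-regular ring $R$ consists of a skew field $D$ with involution, a right vector space $V_D$ with scalar product, and a ring homomorphism $\rho:R\to \mathrm{End}(V_D)$ such that for all $r\in R$, $\rho(r^* )$ is the adjoint of $\rho(r)$, i.e. $\langle\rho(r)v,w\rangle=\langle v,\rho(r^*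 )w\rangle$ for all $v,w\in V$. It is faithful if $\rho$ is injective. A representation of a MOL $L$ consists of such $D,V_D,\langle\cdot,\cdot\rangle$ and a homomorphism of bounded lattices $\iota:L\to L(V_D)$ into the lattice of all subspaces of $V_D$ with $\iota(x^\perp)=\iota(x)^\perp$ for all $x\in L$. For a sectional MOL, $\iota$ is a lattice homomorphism preserving $0$ with $\iota(x^{\prime_b})=\iota(x)^\perp\cap\iota(b)$ for all $x\le b$. It is faithful if $\iota$ is injective. *)

(* Defs.v *)
From HB Require Import structures.
From mathcomp Require Import all_boot all_order all_algebra.
From mathcomp Require Import mathcomp_extra boolp classical_sets.

Set Implicit Arguments.
Unset Strict Implicit.
Unset Printing Implicit Defensive.

Import Order.TTheory GRing.Theory.

Local Open Scope ring_scope.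

Local Obligation Tactic := idtac.

Reserved Notation "x ** y" (at level 40, left associativity).

HB.mixin Record Zmodule_isRng R of GRing.Zmodule R := {
  rmul : R -> R -> R;
  rmulA : associative rmul;
  rmulDl : left_distributive rmul +%R;
  rmulDr : right_distributive rmul +%R
}.

#[short(type="rngType")]
HB.structure Definition Rng := {R of GRing.Zmodule R & Zmodule_isRng R}.

Notation "x ** y" := (rmul x y) : ring_scope.

HB.mixin Record Rng_isStarRng R of Rng R := {
  star : R -> R;
  starD : {morph star : x y / x + y};
  starM : forall x y : R, star (x ** y) = star y ** star x;
  starK : involutive star
}.

#[short(type="starRngType")]
HB.structure Definition StarRng := {R of Rng R & Rng_isStarRng R}.

HB.mixin Record StarRng_isRegular R of StarRng R := {
  rng_regular : forall x : R, exists y : R, x ** y ** x = x;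
  star_proper : forall x : R, x ** star x = 0 -> x = 0
}.

#[short(type="starRegType")]
HB.structure Definition StarReg := {R of StarRng R & StarRng_isRegular R}.

HB.mixin Record Rng_hasUnit R of Rng R := {
  rone : R;
  rmul1r : left_id rone (@rmul R);
  rmulr1 : right_id rone (@rmul R)
}.

#[short(type="ustarRegType")]
HB.structure Definition UStarReg := {R of StarReg R & Rng_hasUnit R}.

Section Ideals.
Variable R : rngType.

Definition two_sided_ideal (I : set R) : Prop :=
  [/\ I 0, forall x y, I x -> I y -> I (x - y)
    & forall r x, I x -> I (r ** x) /\ I (x ** r)].

Definition nonzero_ideal (I : set R) : Prop :=
  two_sided_ideal I /\ exists2 x, I x & x != 0.

Definition subdirectly_irreducible : Prop :=
  exists2 I : set R, nonzero_ideal I &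
    forall J : set R, nonzero_ideal J -> (I `<=` J)%classic.

Definition principal (a : R) : set R := [set x | exists r, x = a ** r].

End Ideals.

Section RngTheory.
Variable R : rngType.
Implicit Types x y z : R.

Lemma rmul0r x : 0 ** x = 0.
Proof. by apply: (addIr (0 ** x)); rewrite -rmulDl !add0r. Qed.
Lemma rmulr0 x : x ** 0 = 0.
Proof. by apply: (addIr (x ** 0)); rewrite -rmulDr !add0r. Qed.
Lemma rmulNr x y : (- x) ** y = - (x ** y).
Proof. by apply: (addIr (x ** y)); rewrite -rmulDl !addNr rmul0r. Qed.
Lemma rmulrN x y : x ** (- y) = - (x ** y).
Proof. by apply: (addIr (x ** y)); rewrite -rmulDr !addNr rmulr0. Qed.
Lemma rmulBl x y z : (x - y) ** z = x ** z - y ** z.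
Proof. by rewrite rmulDl rmulNr. Qed.
Lemma rmulBr x y z : x ** (y - z) = x ** y - x ** z.
Proof. by rewrite rmulDr rmulrN. Qed.

End RngTheory.

Section StarTheory.
Variable R : starRngType.
Implicit Types x y : R.

Lemma star0 : star (0 : R) = 0.
Proof. by apply: (addIr (star 0)); rewrite -starD !add0r. Qed.
Lemma starN x : star (- x) = - star x.
Proof. by apply: (addIr (star x)); rewrite -starD !addNr star0. Qed.
Lemma starB x y : star (x - y) = star x - star y.
Proof. by rewrite starD starN. Qed.

Definition projection (e : R) : Prop := e ** e = e /\ star e = e.

End StarTheory.

HB.mixin Record Lattice_isModular d L of Order.Lattice d L := {
  modular_law : forall x y z : L, (x <= z)%O ->
    (x `|` (y `&` z) = (x `|` y) `&` z)%O
}.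

#[short(type="modLatticeType")]
HB.structure Definition ModLattice d :=
  {L of Order.Lattice d L & Lattice_isModular d L}.

HB.structure Definition BModLattice d :=
  {L of Order.BLattice d L & ModLattice d L}.

(* [scompl b x] is the orthocomplement of [x] in the section [0, b]; its      *)
(* value is irrelevant unless [x <= b].                                       *)
HB.mixin Record isSectionalMOL d L of Order.BLattice d L & ModLattice d L := {
  scompl : L -> L -> L;
  scompl_le : forall b x : L, (x <= b)%O -> (scompl b x <= b)%O;
  scomplK : forall b x : L, (x <= b)%O -> scompl b (scompl b x) = x;
  scompl_anti : forall b x y : L, (x <= y)%O -> (y <= b)%O ->
    (scompl b y <= scompl b x)%O;
  scomplI : forall b x : L, (x <= b)%O -> (x `&` scompl b x = \bot)%O;
  scomplU : forall b x : L, (x <= b)%O -> (x `|` scompl b x = b)%O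
}.

#[short(type="smolType")]
HB.structure Definition SectionalMOL d :=
  {L of Order.BLattice d L & ModLattice d L & isSectionalMOL d L}.

HB.mixin Record isMOL d L of Order.TBLattice d L & ModLattice d L := {
  ocompl : L -> L;
  ocomplK : involutive ocompl;
  ocompl_anti : forall x y : L, (x <= y)%O -> (ocompl y <= ocompl x)%O;
  ocomplI : forall x : L, (x `&` ocompl x = \bot)%O;
  ocomplU : forall x : L, (x `|` ocompl x = \top)%O
}.

#[short(type="molType")]
HB.structure Definition MOL d :=
  {L of Order.TBLattice d L & ModLattice d L & isMOL d L}.

Fact Lbar_display : Order.disp_t. Proof. exact: Order.Disp tt tt. Qed.
Fact subspace_display : Order.disp_t. Proof. exact: Order.Disp tt tt. Qed.

Section Subspaces.
Variables (K : pzRingType) (V : lmodType K).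
Local Open Scope classical_set_scope.

Record subspace := Subspace {
  subspace_set :> V -> Prop;
  subspace0 : subspace_set 0;
  subspaceD : forall v w, subspace_set v -> subspace_set w ->
    subspace_set (v + w);
  subspaceZ : forall (a : K) v, subspace_set v -> subspace_set (a *: v)
}.

HB.instance Definition _ := gen_eqMixin subspace.
HB.instance Definition _ := gen_choiceMixin subspace.

Lemma subspace_eq (U W : subspace) : subspace_set U = subspace_set W -> U = W.
Proof.
case: U W => [U U0 UD UZ] [W W0 WD WZ] /= eqUW; subst W.
by congr Subspace; exact: Prop_irrelevance.
Qed.

Definition subspace_le (U W : subspace) : bool := `[< subspace_set U `<=` subspace_set W >].

Fact subspace_le_refl : reflexive subspace_le.
Proof. by move=> U; apply/asboolP. Qed.
Fact subspace_le_anti : antisymmetric subspace_le.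
Proof.
move=> U W /andP[/asboolP UW /asboolP WU].
by apply: subspace_eq; apply/seteqP; split.
Qed.
Fact subspace_le_trans : transitive subspace_le.
Proof.
move=> U W X /asboolP WU /asboolP UX; apply/asboolP.
exact: subset_trans WU UX.
Qed.

HB.instance Definition _ := Order.Le_isPOrder.Build subspace_display subspace
  subspace_le_refl subspace_le_anti subspace_le_trans.

Program Definition subspace_meet (U W : subspace) : subspace :=
  @Subspace (subspace_set U `&` subspace_set W) _ _ _.
Next Obligation. by move=> U W; split; apply: subspace0. Qed.
Next Obligation. by move=> U W v w [? ?] [? ?]; split; apply: subspaceD. Qed.
Next Obligation. by move=> U W a v [? ?]; split; apply: subspaceZ. Qed.

Program Definition subspace_join (U W : subspace) : subspace :=
  @Subspace [set v | exists u w, [/\ U u, W w & v = u + w]] _ _ _.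
Next Obligation.
by move=> U W; exists 0, 0; rewrite addr0; split=> //; apply: subspace0.
Qed.
Next Obligation.
move=> U W _ _ [u [w [Uu Ww ->]]] [u' [w' [Uu' Ww' ->]]].
by exists (u + u'), (w + w'); rewrite addrACA; split=> //; apply: subspaceD.
Qed.
Next Obligation.
move=> U W a _ [u [w [Uu Ww ->]]].
by exists (a *: u), (a *: w); rewrite scalerDr; split=> //; apply: subspaceZ.
Qed.

Program Definition subspace_bot : subspace := @Subspace [set 0] _ _ _.
Next Obligation. by []. Qed.
Next Obligation. by move=> v w /= -> ->; rewrite addr0. Qed.
Next Obligation. by move=> a v /= ->; rewrite scaler0. Qed.

Definition subspace_top : subspace :=
  @Subspace setT I (fun _ _ _ _ => I) (fun _ _ _ => I).

Fact subspace_lexI (X U W : subspace) :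
  (X <= subspace_meet U W)%O = (X <= U)%O && (X <= W)%O.
Proof.
apply/asboolP/andP => [XUW | [/asboolP XU /asboolP XW] x Xx].
  by split; apply/asboolP => x /XUW[].
by split; [apply: XU | apply: XW].
Qed.

Fact subspace_leUx (U W X : subspace) :
  (subspace_join U W <= X)%O = (U <= X)%O && (W <= X)%O.
Proof.
apply/asboolP/andP => [UWX | [/asboolP UX /asboolP WX] _ [u [w [Uu Ww ->]]]].
  split; apply/asboolP => x ?; apply: UWX.
    by exists x, 0; rewrite addr0; split=> //; apply: subspace0.
  by exists 0, x; rewrite add0r; split=> //; apply: subspace0.
by apply: subspaceD; [apply: UX | apply: WX].
Qed.

HB.instance Definition _ :=
  Order.POrder_MeetJoin_isLattice.Build subspace_display subspace
    subspace_lexI subspace_leUx.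

Fact subspace_le0x (U : subspace) : (subspace_bot <= U)%O.
Proof. by apply/asboolP => _ ->; apply: subspace0. Qed.
Fact subspace_lex1 (U : subspace) : (U <= subspace_top)%O.
Proof. by apply/asboolP. Qed.

HB.instance Definition _ :=
  Order.hasBottom.Build subspace_display subspace subspace_le0x.
HB.instance Definition _ :=
  Order.hasTop.Build subspace_display subspace subspace_lex1.

End Subspaces.

Section Lbar.
Variable R : starRegType.
Implicit Types a b e f x y : R.
Local Open Scope classical_set_scope.

Record Lbar := PrincipalIdeal {
  Lbar_set :> R -> Prop;
  Lbar_principal : exists a, Lbar_set = principal a
}.

HB.instance Definition _ := gen_eqMixin Lbar.
HB.instance Definition _ := gen_choiceMixin Lbar.

Definition pideal a : Lbar := PrincipalIdeal (ex_intro _ a erefl).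

Lemma Lbar_eq (I J : Lbar) : Lbar_set I = Lbar_set J -> I = J.
Proof.
case: I J => [I pI] [J pJ] /= eqIJ; subst J.
by congr PrincipalIdeal; exact: Prop_irrelevance.
Qed.

Definition Lbar_le (I J : Lbar) : bool := `[< Lbar_set I `<=` Lbar_set J >].

Fact Lbar_le_refl : reflexive Lbar_le.
Proof. by move=> I; apply/asboolP. Qed.
Fact Lbar_le_anti : antisymmetric Lbar_le.
Proof.
move=> I J /andP[/asboolP IJ /asboolP JI].
by apply: Lbar_eq; apply/seteqP; split.
Qed.
Fact Lbar_le_trans : transitive Lbar_le.
Proof.
move=> I J K /asboolP JI /asboolP IK; apply/asboolP; exact: subset_trans JI IK.
Qed.

HB.instance Definition _ := Order.Le_isPOrder.Build Lbar_display Lbar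
  Lbar_le_refl Lbar_le_anti Lbar_le_trans.

Lemma star_proper' x : star x ** x = 0 -> x = 0.
Proof.
move=> xx0; rewrite -[x]starK -[RHS]star0; congr star.
by apply: star_proper; rewrite starK.
Qed.

Lemma projection_exists a : exists2 e, projection e &
  principal a = principal e.
Proof.
have [y ry] := rng_regular (star a ** a).
have aE : a ** y ** star a ** a = a.
  set d := a ** y ** star a ** a - a.
  have ad : star a ** d = 0.
    by rewrite /d rmulBr !rmulA -[_ ** _ ** star a ** a]rmulA ry subrr.
  suff /eqP : d = 0 by rewrite subr_eq0 => /eqP.
  apply: star_proper'.
  by rewrite {1}/d starB !starM starK rmulBl -!rmulA ad !rmulr0 subrr.
set e := a ** y ** star a.
have ee : e ** e = e.
  by rewrite /e !rmulA aE.
have es : star e = e.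
  have h : e ** star e = star e.
    by rewrite /e !starM starK !rmulA aE.
  by move: (congr1 star h); rewrite starM !starK h.
exists e; first by split.
apply/seteqP; split=> _ [r ->].
  by exists (a ** r); rewrite rmulA aE.
by exists (y ** star a ** r); rewrite !rmulA.
Qed.

Lemma Lbar_projection (I : Lbar) : {e | projection e & I = pideal e}.
Proof.
apply: cid2; case: I => I pI; have [a eqI] := pI.
have [e pe eqe] := projection_exists a; exists e => //.
by apply: Lbar_eq; rewrite /= eqI eqe.
Qed.

(* the unique projection generating a given principal right ideal *)
Definition Lproj (I : Lbar) : R := s2val (Lbar_projection I).

Lemma LprojP I : projection (Lproj I).
Proof. exact: s2valP (Lbar_projection I). Qed.
Lemma LprojE I : I = pideal (Lproj I).
Proof. exact: s2valP' (Lbar_projection I). Qed.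

Lemma mem_pideal e x : e ** e = e -> pideal e x <-> e ** x = x.
Proof.
by move=> ee; split=> [[r ->] | <-]; [rewrite rmulA ee | exists x].
Qed.

Lemma pideal_le e f : e ** e = e -> f ** f = f ->
  (pideal e <= pideal f)%O <-> f ** e = e.
Proof.
move=> ee ff; split=> [/asboolP ef | fe].
  by apply/mem_pideal => //; apply: ef; apply/mem_pideal.
by apply/asboolP => x /mem_pideal -/(_ ee) <-; exists (e ** x); rewrite rmulA fe.
Qed.

Lemma projection_uniq e f : projection e -> projection f ->
  pideal e = pideal f -> e = f.
Proof.
move=> [ee es] [ff fs] eqI.
have fe : f ** e = e by apply/pideal_le => //; rewrite eqI.
have ef : e ** f = f by apply/pideal_le => //; rewrite eqI.
by rewrite -[LHS]es -fe starM es fs.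
Qed.

Lemma Lproj_pideal e : projection e -> Lproj (pideal e) = e.
Proof.
by move=> pe; apply: projection_uniq (LprojP _) pe _; rewrite -LprojE.
Qed.

Lemma Lbar_join_principal (I J : Lbar) :
  exists a, [set x | exists u w, [/\ I u, J w & x = u + w]] = principal a.
Proof.
rewrite (LprojE I) (LprojE J).
have [ee _] := LprojP I; have [ff _] := LprojP J.
move: (Lproj I) (Lproj J) ee ff => e b ee bb.
pose c := b - e ** b.
have ec : e ** c = 0 by rewrite /c rmulBr rmulA ee subrr.
have [y cyc] := rng_regular c.
pose f := c ** y.
have ef : e ** f = 0 by rewrite /f rmulA ec rmul0r.
have ff : f ** f = f by rewrite /f rmulA cyc.
pose g := e + f - f ** e.
have ge : g ** e = e by rewrite /g rmulBl rmulDl ee -rmulA ee addrK.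
have gc : g ** c = c.
  by rewrite /g rmulBl rmulDl -rmulA ec rmulr0 add0r subr0 /f cyc.
exists g; apply/seteqP; split.
  move=> x [_] [_] [[r ->] [s ->] ->].
  exists (e ** r + b ** s); rewrite rmulDr !rmulA ge; congr (_ + _).
  by rewrite -[b in g ** b](subrK (e ** b)) -/c rmulDr gc rmulA ge subrK.
move=> x [r ->].
pose s := y ** r - y ** (e ** r).
exists (e ** (r - b ** s)), (b ** s); split.
- by exists (r - b ** s).
- by exists s.
have -> : g ** r = e ** r + c ** s.
  by rewrite /g rmulBl rmulDl /s rmulBr !rmulA /f addrA.
by rewrite /c rmulBr rmulBl !rmulA addrA addrAC.
Qed.

Lemma Lbar_meet_principal (I J : Lbar) : exists a, Lbar_set I `&` Lbar_set J = principal a.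
Proof.
rewrite (LprojE I) (LprojE J).
have [ee _] := LprojP I; have [ff _] := LprojP J.
move: (Lproj I) (Lproj J) ee ff => e f ee ff.
pose c := f - e ** f.
have cf : c ** f = c by rewrite /c rmulBl -rmulA ff.
have [y cyc] := rng_regular c.
pose h := f - f ** y ** c.
have fh : f ** h = h by rewrite /h rmulBr !rmulA ff.
have ch : c ** h = 0 by rewrite /h rmulBr !rmulA cf cyc subrr.
have eh : e ** h = h.
  apply/eqP; rewrite eq_sym -subr_eq0 -{1}fh -[in X in _ - X]fh rmulA -rmulBl.
  by rewrite -/c ch.
exists h; apply/seteqP; split=> x.
  move=> [/mem_pideal -/(_ ee) ex /mem_pideal -/(_ ff) fx].
  have cx : c ** x = 0 by rewrite /c rmulBl -rmulA fx ex subrr.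
  by exists x; rewrite /h rmulBl -rmulA cx rmulr0 subr0 fx.
by move=> [r ->]; split; exists (h ** r); rewrite rmulA ?eh ?fh.
Qed.

Definition Lbar_meet (I J : Lbar) := PrincipalIdeal (Lbar_meet_principal I J).
Definition Lbar_join (I J : Lbar) := PrincipalIdeal (Lbar_join_principal I J).

Lemma Lbar0 (I : Lbar) : I 0.
Proof. by rewrite (LprojE I); exists 0; rewrite rmulr0. Qed.
Lemma LbarD (I : Lbar) x y : I x -> I y -> I (x + y).
Proof.
by rewrite (LprojE I) => -[r ->] [s ->]; exists (r + s); rewrite rmulDr.
Qed.
Lemma LbarN (I : Lbar) x : I x -> I (- x).
Proof. by rewrite (LprojE I) => -[r ->]; exists (- r); rewrite rmulrN. Qed.

Fact Lbar_lexI (X I J : Lbar) :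
  (X <= Lbar_meet I J)%O = (X <= I)%O && (X <= J)%O.
Proof.
apply/asboolP/andP => [XIJ | [/asboolP XI /asboolP XJ] x Xx].
  by split; apply/asboolP => x /XIJ[].
by split; [apply: XI | apply: XJ].
Qed.

Fact Lbar_leUx (I J X : Lbar) :
  (Lbar_join I J <= X)%O = (I <= X)%O && (J <= X)%O.
Proof.
apply/asboolP/andP => [IJX | [/asboolP IX /asboolP JX] _ [u [w [Iu Jw ->]]]].
  split; apply/asboolP => x ?; apply: IJX.
    by exists x, 0; rewrite addr0; split=> //; apply: Lbar0.
  by exists 0, x; rewrite add0r; split=> //; apply: Lbar0.
by apply: LbarD; [apply: IX | apply: JX].
Qed.

HB.instance Definition _ :=
  Order.POrder_MeetJoin_isLattice.Build Lbar_display Lbar Lbar_lexI Lbar_leUx.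

Fact Lbar_le0x (I : Lbar) : (pideal 0 <= I)%O.
Proof. by apply/asboolP => _ [r ->]; rewrite rmul0r; apply: Lbar0. Qed.

HB.instance Definition _ := Order.hasBottom.Build Lbar_display Lbar Lbar_le0x.

Fact Lbar_modular (x y z : Lbar) : (x <= z)%O ->
  (x `|` (y `&` z) = (x `|` y) `&` z)%O.
Proof.
move=> xz; apply/le_anti/andP; split.
  by rewrite leUx !lexI leUl xz leIr andbT (le_trans (leIl _ _) (leUr _ _)).
have /asboolP xz' := xz.
apply/asboolP => _ [[u [w [xu yw ->]]] zuw].
exists u, w; split=> //; split=> //.
by rewrite -[w](addKr u); apply: LbarD => //; apply: LbarN; apply: xz'.
Qed.

HB.instance Definition _ := Lattice_isModular.Build Lbar_display Lbar
  Lbar_modular.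

(* (e R)'_(f R) = (f - e) R for projections e, f with e R <= f R *)
Definition Lbar_scompl (b x : Lbar) : Lbar := pideal (Lproj b - Lproj x).

Lemma Lproj_le (x b : Lbar) : (x <= b)%O ->
  Lproj b ** Lproj x = Lproj x /\ Lproj x ** Lproj b = Lproj x.
Proof.
have [ee es] := LprojP x; have [ff fs] := LprojP b.
rewrite {1}(LprojE x) {1}(LprojE b) => /pideal_le -/(_ ee ff) fe; split=> //.
by move: (congr1 star fe); rewrite starM es fs.
Qed.

Lemma projectionB (x b : Lbar) : (x <= b)%O -> projection (Lproj b - Lproj x).
Proof.
have [ee es] := LprojP x; have [ff fs] := LprojP b.
move=> /Lproj_le[fe ef]; split; last by rewrite starB es fs.
by rewrite rmulBl !rmulBr ee ff fe ef subrr subr0.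
Qed.

Lemma Lproj_scompl (b x : Lbar) : (x <= b)%O ->
  Lproj (Lbar_scompl b x) = Lproj b - Lproj x.
Proof. by move=> /projectionB /Lproj_pideal. Qed.

Fact Lbar_scompl_le (b x : Lbar) : (x <= b)%O -> (Lbar_scompl b x <= b)%O.
Proof.
move=> xb; rewrite [leRHS]LprojE.
have [gg _] := projectionB xb; have [ff _] := LprojP b.
have [fe _] := Lproj_le xb.
by apply/pideal_le => //; rewrite rmulBr ff fe.
Qed.

Fact Lbar_scomplK (b x : Lbar) : (x <= b)%O ->
  Lbar_scompl b (Lbar_scompl b x) = x.
Proof.
move=> xb; rewrite {1}/Lbar_scompl Lproj_scompl // opprB addrC subrK.
by rewrite -LprojE.
Qed.

Fact Lbar_scompl_anti (b x y : Lbar) : (x <= y)%O -> (y <= b)%O ->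
  (Lbar_scompl b y <= Lbar_scompl b x)%O.
Proof.
move=> xy yb; have xb := le_trans xy yb.
have [gg _] := projectionB xb; have [hh _] := projectionB yb.
have [ff _] := LprojP b.
have [_ xyE] := Lproj_le xy; have [_ xbE] := Lproj_le xb.
have [byE _] := Lproj_le yb.
by apply/pideal_le => //; rewrite rmulBl !rmulBr ff byE xbE xyE subrr subr0.
Qed.

Fact Lbar_scomplI (b x : Lbar) : (x <= b)%O ->
  (x `&` Lbar_scompl b x = \bot)%O.
Proof.
move=> xb; apply/le_anti; rewrite le0x andbT; apply/asboolP => v [].
rewrite {1}(LprojE x) => /mem_pideal -/(_ (LprojP x).1) xv.
move=> /mem_pideal -/(_ (projectionB xb).1) cv.
have [_ xbE] := Lproj_le xb.
suff -> : v = 0 by apply: Lbar0.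
by rewrite -xv -cv rmulA rmulBr xbE (LprojP x).1 subrr rmul0r.
Qed.

Fact Lbar_scomplU (b x : Lbar) : (x <= b)%O ->
  (x `|` Lbar_scompl b x = b)%O.
Proof.
move=> xb; apply/le_anti; rewrite leUx xb Lbar_scompl_le //=.
apply/asboolP => v; rewrite {1}(LprojE b) => -[r ->].
exists (Lproj x ** r), ((Lproj b - Lproj x) ** r); split.
- by rewrite [in Lbar_set x](LprojE x); exists r.
- by exists r.
- by rewrite rmulBl addrC subrK.
Qed.

HB.instance Definition _ := isSectionalMOL.Build Lbar_display Lbar
  Lbar_scompl_le Lbar_scomplK Lbar_scompl_anti Lbar_scomplI Lbar_scomplU.

End Lbar.

Section UnitalLbar.
Variable R : ustarRegType.

Lemma projection1 : projection (rone : R).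
Proof.
split; first by rewrite rmul1r.
by move: (congr1 star (rmulr1 (star (rone : R)))); rewrite starM !starK rmulr1.
Qed.

Fact Lbar_lex1 (I : Lbar R) : (I <= pideal rone)%O.
Proof. by apply/asboolP => x _; exists x; rewrite rmul1r. Qed.

HB.instance Definition _ :=
  Order.hasTop.Build Lbar_display (Lbar R) Lbar_lex1.

(* (e R)^\perp = (1 - e) R for a projection e *)
Definition Lbar_ocompl (x : Lbar R) : Lbar R := pideal (rone - Lproj x).

Lemma Lbar_ocomplE x : Lbar_ocompl x = scompl (\top%O : Lbar R) x.
Proof. by rewrite /Lbar_ocompl -(Lproj_pideal projection1). Qed.

Fact Lbar_ocomplK : involutive Lbar_ocompl.
Proof. by move=> x; rewrite !Lbar_ocomplE scomplK ?lex1. Qed.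
Fact Lbar_ocompl_anti (x y : Lbar R) :
  (x <= y)%O -> (Lbar_ocompl y <= Lbar_ocompl x)%O.
Proof. by move=> xy; rewrite !Lbar_ocomplE scompl_anti ?lex1. Qed.
Fact Lbar_ocomplI (x : Lbar R) : (x `&` Lbar_ocompl x = \bot)%O.
Proof. by rewrite Lbar_ocomplE scomplI ?lex1. Qed.
Fact Lbar_ocomplU (x : Lbar R) : (x `|` Lbar_ocompl x = \top)%O.
Proof. by rewrite Lbar_ocomplE scomplU ?lex1. Qed.

HB.instance Definition _ := isMOL.Build Lbar_display (Lbar R)
  Lbar_ocomplK Lbar_ocompl_anti Lbar_ocomplI Lbar_ocomplU.

End UnitalLbar.

HB.mixin Record UnitRing_isStarSkewField D of GRing.UnitRing D := {
  skew_field : forall x : D, x != 0 -> x \is a GRing.unit;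
  dstar : D -> D;
  dstarD : {morph dstar : x y / x + y};
  dstarM : forall x y : D, dstar (x * y) = dstar y * dstar x;
  dstarK : involutive dstar
}.

#[short(type="starSkewFieldType")]
HB.structure Definition StarSkewField :=
  {D of GRing.UnitRing D & UnitRing_isStarSkewField D}.

(* A right vector space over D is a left module over the converse ring D^c;   *)
(* [(a : D^c) *: v] is the vector usually written v a.                        *)
Record scalar_product (D : starSkewFieldType) (V : lmodType D^c) :=
  ScalarProduct {
  form :> V -> V -> D;
  form_addl : forall u v w, form (u + v) w = form u w + form v w;
  form_addr : forall u v w, form u (v + w) = form u v + form u w;
  form_sesqui : forall (a b : D) v w,
    form ((a : D^c) *: v) ((b : D^c) *: w) = dstar a * form v w * b;
  form_hermitian : forall v w, form w v = dstar (form v w);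
  form_anisotropic : forall v, form v v = 0 -> v = 0
}.

Section Orthogonal.
Variables (D : starSkewFieldType) (V : lmodType D^c) (f : scalar_product V).

Lemma form0l v : f 0 v = 0.
Proof. by apply: (addIr (f 0 v)); rewrite -form_addl !add0r. Qed.
Lemma form0r v : f v 0 = 0.
Proof. by apply: (addIr (f v 0)); rewrite -form_addr !add0r. Qed.

Program Definition orth (U : subspace V) : subspace V :=
  @Subspace _ V [set v | forall u, U u -> f u v = 0]%classic _ _ _.
Next Obligation. by move=> U u _; rewrite form0r. Qed.
Next Obligation.
by move=> U v w Uv Uw u Uu; rewrite form_addr Uv ?Uw ?addr0.
Qed.
Next Obligation.
move=> U a v Uv u Uu; rewrite -[u]scale1r.
by rewrite (form_sesqui f 1 a) Uv // mulr0 mul0r.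
Qed.

End Orthogonal.

Section Representations.

(* MathComp's {blmorphism _ -> _} and {tblmorphism _ -> _} only record the     *)
(* preservation of \bot and \top, so all conditions are listed explicitly.    *)
Definition MOL_rep d (L : molType d) (D : starSkewFieldType)
    (V : lmodType D^c) (f : scalar_product V) (iota : L -> subspace V) : Prop :=
  [/\ forall x y : L, iota (x `&` y)%O = (iota x `&` iota y)%O,
      forall x y : L, iota (x `|` y)%O = (iota x `|` iota y)%O,
      iota \bot%O = \bot%O,
      iota \top%O = \top%O
    & forall x : L, iota (ocompl x) = orth f (iota x)].

Definition sectional_MOL_rep d (L : smolType d) (D : starSkewFieldType)
    (V : lmodType D^c) (f : scalar_product V) (iota : L -> subspace V) : Prop :=
  [/\ forall x y : L, iota (x `&` y)%O = (iota x `&` iota y)%O,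
      forall x y : L, iota (x `|` y)%O = (iota x `|` iota y)%O,
      iota \bot%O = \bot%O
    & forall b x : L, (x <= b)%O ->
        iota (scompl b x) = (orth f (iota x) `&` iota b)%O].

Definition linear_rep (R : starRngType) (D : starSkewFieldType)
    (V : lmodType D^c) (f : scalar_product V)
    (rho : R -> {linear V -> V}) : Prop :=
  [/\ forall r s v, rho (r + s) v = rho r v + rho s v,
      forall r s v, rho (r ** s) v = rho r (rho s v)
    & forall r v w, f (rho r v) w = f v (rho (star r) w)].

Definition has_faithful_MOL_rep d (L : molType d) : Prop :=
  exists (D : starSkewFieldType) (V : lmodType D^c) (f : scalar_product V)
    (iota : L -> subspace V),
    MOL_rep f iota /\ injective iota.

Definition has_faithful_sectional_MOL_rep d (L : smolType d) : Prop :=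
  exists (D : starSkewFieldType) (V : lmodType D^c) (f : scalar_product V)
    (iota : L -> subspace V),
    sectional_MOL_rep f iota /\ injective iota.

Definition has_faithful_linear_rep (R : starRngType) : Prop :=
  exists (D : starSkewFieldType) (V : lmodType D^c) (f : scalar_product V)
    (rho : R -> {linear V -> V}),
    linear_rep f rho /\ injective (fun r => rho r : V -> V).

End Representations.

(* Main.v *)
From HB Require Import structures.
From mathcomp Require Import all_boot all_order all_algebra.
From mathcomp Require Import boolp classical_sets.
Require Import Defs.

(** Let I be the smallest nonzero ideal. For every nonzero projection e in I, R
    acts faithfully on R e by left multiplication. If some such e is minimal,
    then e R e is a skew field and R e, with the form <x, y> = x^* y, is a
    faithful representation. Otherwise I contains three nonzero, pairwise
    orthogonal and pairwise isomorphic projections e, h2, h3. For c in f R e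
    with e R and f R independent, the right ideal (e - c) R is the graph of
    - c : e R -> f R, so that its image under the given lattice representation
    iota is the graph of a linear map from iota(e R) to iota(f R). As in von
    Staudt's coordinatization, these maps respect sums and composites, and h2
    and h3 supply the room needed to define the map even for c in e R e. This
    assigns to each x in R e a map T_x : iota(e R) -> V with
    <T_x v, T_y w> = <v, T_(x^* y) w>. On the span of all T_x v, put
    r (T_x v) = T_(r x) v; anisotropy of the form makes this well defined, and
    the identity above shows that r^* acts as the adjoint of r. *)

Set Implicit Arguments.
Unset Strict Implicit.
Unset Printing Implicit Defensive.

Import Order.TTheory GRing.Theory.

Local Open Scope ring_scope.

Local Obligation Tactic := idtac.

(** * Independent principal right ideals and range projections *)

Section Independence.
Variable R : starRegType.
Implicit Types a b c e f g r s x y z : R.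

(** The right ideals a R and b R meet in 0; similarly, [indep3] makes the sum of three right ideals
    direct. Both are phrased with elements so that they apply directly to equations in R. *)
Definition indep2 a b := forall x y, a ** x = b ** y -> a ** x = 0.

Definition indep3 a b c := forall x y z, a ** x + b ** y + c ** z = 0 ->
  [/\ a ** x = 0, b ** y = 0 & c ** z = 0].

Lemma indep3_swap a b c : indep3 a b c -> indep3 b a c.
Proof. by move=> i x y z; rewrite [b ** x + _]addrC => /i[]. Qed.

Lemma indep3_rot a b c : indep3 a b c -> indep3 b c a.
Proof. by move=> i x y z; rewrite addrC addrA => /i[]. Qed.

Lemma indep3_2 a b c : indep3 a b c -> indep2 a b.
Proof.
move=> i x y axby.
have [|//] := i x (- y) 0.
by rewrite rmulr0 addr0 rmulrN axby subrr.
Qed.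

Lemma indep3_eq a b c x y z x' y' z' : indep3 a b c ->
  a ** x + b ** y + c ** z = a ** x' + b ** y' + c ** z' ->
  [/\ a ** x = a ** x', b ** y = b ** y' & c ** z = c ** z'].
Proof.
move=> i /eqP; rewrite -subr_eq0 opprD addrACA -rmulBr opprD.
rewrite [X in X + _]addrACA -!rmulBr.
move=> /eqP/i[]; rewrite !rmulBr.
by do 3![move=> /eqP; rewrite subr_eq0 => /eqP ->].
Qed.

Lemma orth_indep2 e f : e ** e = e -> e ** f = 0 -> indep2 e f.
Proof.
by move=> ee ef x y exfy; rewrite -ee -rmulA exfy rmulA ef rmul0r.
Qed.

Lemma orth_indep3 e f g : e ** e = e -> e ** f = 0 -> e ** g = 0 ->
  indep2 f g -> indep3 e f g.
Proof.
move=> ee ef eg fg x y z s0.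
have ex : e ** x = 0.
  move/(congr1 (rmul e)): s0.
  by rewrite !rmulDr !rmulA ee ef eg !rmul0r rmulr0 !addr0.
move: s0; rewrite ex add0r => /eqP; rewrite addr_eq0 -rmulrN => /eqP fygz.
have fy := fg _ _ fygz.
by split=> //; apply/eqP; rewrite -oppr_eq0 -rmulrN -fygz fy.
Qed.

Lemma projection_range a : exists2 p, projection p &
  [/\ p ** a = a, (exists x, p = a ** x) & principal a = principal p].
Proof.
have [p pp ap] := projection_exists a; exists p => //.
have [ppp _] := pp; split=> //.
  have : principal a a.
    by have [y ay] := rng_regular a; exists (y ** a); rewrite rmulA.
  by rewrite ap => -[r ->]; rewrite rmulA ppp.
have : principal p p by exists p.
by rewrite -ap.
Qed.

Lemma orthC (e f : R) : projection e -> projection f ->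
  e ** f = 0 -> f ** e = 0.
Proof.
by move=> [_ es] [_ fs] ef; rewrite -es -fs -starM ef star0.
Qed.

(** The projection onto c R + d R gives two elements a common codomain orthogonal to e, as the
    addition of graph maps requires. *)
Lemma orth_range2 e c d : projection e -> e ** c = 0 -> e ** d = 0 ->
  exists2 f, projection f & [/\ f ** c = c, f ** d = d & e ** f = 0].
Proof.
move=> pe ec ed; have [a ha] := Lbar_join_principal (pideal c) (pideal d).
have [p pp [_ _ ap]] := projection_range a; rewrite ap in ha.
have regm z : pideal z z.
  by have [y zy] := rng_regular z; exists (y ** z); rewrite rmulA.
exists p => //; have [ppp _] := pp; split.
- have [] : principal p c; last by move=> r ->; rewrite rmulA ppp.
  by rewrite -ha; exists c, 0; rewrite addr0; split=> //; apply: Lbar0.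
- have [] : principal p d; last by move=> r ->; rewrite rmulA ppp.
  by rewrite -ha; exists 0, d; rewrite add0r; split=> //; apply: Lbar0.
- have : principal p p by exists p.
  rewrite -ha => -[u [w [[x ->] [y ->] ->]]].
  by rewrite rmulDr !rmulA ec ed !rmul0r addr0.
Qed.

(* [f0] generates the intersection of [f ** R] and [h ** R] *)
Lemma projection_split f h : projection f -> projection h ->
  exists f0 f1 : R, [/\ projection f0, projection f1, f0 + f1 = f &
    [/\ f ** f0 = f0, f0 ** f1 = 0, h ** f0 = f0 & indep2 f1 h]].
Proof.
move=> pf ph; have [ff fs] := pf; have [hh hs] := ph.
have [a ha] := Lbar_meet_principal (pideal f) (pideal h).
have [p pp [_ _ ap]] := projection_range a; rewrite ap in ha.
have [ppp ps] := pp.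
have : principal p p by exists p.
rewrite -ha => -[/(mem_pideal _ ff) fp /(mem_pideal _ hh) hp].
have pf' : p ** f = p by rewrite -ps -{1}fs -starM fp.
exists p, (f - p); split; [by []| |by rewrite addrC subrK|split=> //].
- split; last by rewrite starB fs ps.
  by rewrite rmulBl !rmulBr ff fp pf' ppp subrr subr0.
- by rewrite rmulBr pf' ppp subrr.
- move=> x y xy.
  have : principal p ((f - p) ** x).
    rewrite -ha; split; last by rewrite xy; exists y.
    by apply/mem_pideal => //; rewrite rmulA rmulBr ff fp.
  move=> [r xr]; rewrite xr -ppp -rmulA -xr rmulA rmulBr pf' ppp subrr.
  by rewrite rmul0r.
Qed.

End Independence.

(** * Images of right ideals under [iota], and maps defined by their graphs *)

Section Graphs.
Variables (R : starRegType) (D : starSkewFieldType) (V : lmodType D^c).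
Variables (B : scalar_product V) (iota : Lbar R -> subspace V).
Hypothesis rep : sectional_MOL_rep B iota.
Implicit Types (a b c d e f g h r s t x y z : R) (u v w : V).

Definition img a : subspace V := iota (pideal a).

Lemma formBl u v w : B (u - v) w = B u w - B v w.
Proof. by apply/eqP; rewrite eq_sym subr_eq -form_addl subrK. Qed.
Lemma subspaceB (U : subspace V) v w : U v -> U w -> U (v - w).
Proof.
by move=> Uv Uw; apply: subspaceD => //; rewrite -scaleN1r; apply: subspaceZ.
Qed.

Lemma iota_mono I J : (I <= J)%O -> (iota I <= iota J)%O.
Proof. by case: rep => hI _ _ _ /meet_l {1}<-; rewrite hI leIr. Qed.

(* Inclusions of the form (aR + bR) n (cR + dR) <= gR transfer along [iota]. *)
Lemma img_meet a b c d g :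
  (forall x y z t, a ** x + b ** y = c ** z + d ** t ->
     exists k, a ** x + b ** y = g ** k) ->
  forall v1 v2 w1 w2, img a v1 -> img b v2 -> img c w1 -> img d w2 ->
  v1 + v2 = w1 + w2 -> img g (v1 + v2).
Proof.
move=> hg v1 v2 w1 w2 av bv cw dw vw.
case: rep => hI hU _ _.
have /iota_mono : ((pideal a `|` pideal b) `&` (pideal c `|` pideal d)
    <= pideal g)%O.
  apply/asboolP => _ [[_ [_ [[x ->] [y ->] ->]]] [_ [_ [[z ->] [t ->] e]]]].
  by have [k ->] := hg _ _ _ _ e; exists k.
rewrite hI !hU => /asboolP; apply; split; first by exists v1, v2.
by rewrite vw; exists w1, w2.
Qed.

Lemma img0 a : img a 0.
Proof. exact: subspace0. Qed.

Lemma img_sub a g : (forall x, exists k, a ** x = g ** k) ->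
  forall v, img a v -> img g v.
Proof.
move=> ag v av; apply: (asboolW (iota_mono _)) av.
by apply/asboolP => _ [x ->]; have [k ->] := ag x; exists k.
Qed.

Lemma img_subl a f v : f ** a = a -> img a v -> img f v.
Proof.
by move=> fa; apply: img_sub => x; exists (a ** x); rewrite rmulA fa.
Qed.

Lemma img_eq0 v : img 0 v -> v = 0.
Proof. by rewrite /img; case: rep => _ _ -> _. Qed.

Lemma img_meet0 a b v : indep2 a b -> img a v -> img b v -> v = 0.
Proof.
move=> ab av bv; apply: img_eq0; rewrite -[v]addr0.
apply: (img_meet _ av (img0 a) bv (img0 b)) => // x y z t.
rewrite -!rmulDr => /ab ->; exists 0; by rewrite rmulr0.
Qed.

Lemma img_join a b g : (forall x, exists y z, g ** x = a ** y + b ** z) ->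
  forall v, img g v -> exists w u, [/\ img a w, img b u & v = w + u].
Proof.
move=> h v gv; case: rep => _ hU _ _.
have : iota (pideal a `|` pideal b)%O v.
  apply: (asboolW (iota_mono _)) gv.
  apply/asboolP => _ [x ->]; have [y [z ->]] := h x.
  by exists (a ** y), (b ** z); split=> //; [exists y | exists z].
by rewrite hU => -[w [u [? ? ?]]]; exists w, u.
Qed.

(** Orthogonality has to be expressed by a sectional complement: for the range projections p of a
    and q of b, q R is the complement of p R below (p + q) R. *)
Lemma img_orth a b v w : star a ** b = 0 -> img a v -> img b w -> B v w = 0.
Proof.
move=> ab av bw.
have [p pp [_ [x px] /esym ap]] := projection_range a.
have [q pq [_ [y qy] /esym bq]] := projection_range b.
have paE : pideal a = pideal p by apply: Lbar_eq.
have pbE : pideal b = pideal q by apply: Lbar_eq.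
have [ppp ps] := pp; have [qqq qs] := pq.
have pq0 : p ** q = 0.
  by rewrite -ps px qy starM rmulA -[_ ** star a ** b]rmulA ab rmulr0 rmul0r.
have qp0 := orthC pp pq pq0.
have ps' : projection (p + q).
  split; last by rewrite starD ps qs.
  by rewrite rmulDl !rmulDr ppp qqq pq0 qp0 addr0 add0r.
have le : (pideal p <= pideal (p + q))%O.
  by apply/pideal_le => //; [case: ps' | rewrite rmulDl ppp qp0 addr0].
have qE : pideal q = scompl (pideal (p + q)) (pideal p).
  by rewrite /scompl /= /Lbar_scompl !Lproj_pideal // [p + q]addrC addrK.
case: rep => _ _ _ hC.
move: bw; rewrite /img pbE qE hC // => -[ow _].
by apply: ow; rewrite -paE.
Qed.


(* The map [iota (e ** R) -> iota (c ** R)] whose negative has the image of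
   [(e - c) ** R] as its graph; meaningful when [c ** e = c], [e ** R] and
   [c ** R] are independent, and [img e v]. *)
Definition phi e c v : V :=
  xget 0 [set w | img c w /\ img (e - c) (v - w)]%classic.

(** A value exists because e R is contained in c R + (e - c) R. *)
Lemma phiP e c v : img e v ->
  img c (phi e c v) /\ img (e - c) (v - phi e c v).
Proof.
move=> ev; have [|w [u [cw ecu vE]]] := @img_join c (e - c) _ _ v ev.
  by move=> x; exists x, x; rewrite -rmulDl addrC subrK.
apply: (@xgetPex _ 0 [set w | img c w /\ img (e - c) (v - w)]%classic).
by exists w; split; rewrite // vE [w + u]addrC addrK.
Qed.

Lemma phi_codom e f c v : f ** c = c -> img e v -> img f (phi e c v).
Proof. by move=> fc ev; apply: img_subl fc _; case: (phiP c ev). Qed.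

(** Two candidates differ by a vector in the images of both (e - (c + d)) R and f R + g R, and these
    right ideals meet in 0. The codomain has two summands for the sake of [phi_block]. *)
Lemma phi_uniq2 e f g c d v w u : indep3 e f g ->
  f ** c = c -> c ** e = c -> g ** d = d -> d ** e = d ->
  img e v -> img f w -> img g u -> img (e - (c + d)) (v - (w + u)) ->
  phi e (c + d) v = w + u.
Proof.
move=> i fc ce gd de ev fw gu gr.
have [cdz ecdz] := phiP (c + d) ev.
set z := phi _ _ _ in cdz ecdz *.
have [|z0 [z1 [fz0 gz1 zE]]] := @img_join f g _ _ z cdz.
  by move=> x; exists (c ** x), (d ** x); rewrite !rmulA fc gd rmulDl.
have : img 0 ((v - (w + u)) - (v - z) + 0).
  apply: (@img_meet (e - (c + d)) 0 f g) _ (subspaceB gr ecdz) (img0 0)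
    (subspaceB fz0 fw) (subspaceB gz1 gu) _ => [x y x' y'|].
    rewrite rmul0r addr0 rmulBl => E.
    have [] := i x (- (c ** x) - x') (- (d ** x) - y').
      rewrite !rmulBr !rmulrN !rmulA fc gd -addrA [X in _ + X]addrACA.
      by rewrite -!opprD -rmulDl opprD addrA E subrr.
    move=> ex _ _; exists 0.
    by rewrite ex -[in LHS]ce -de -rmulDl -rmulA ex !rmulr0 subr0.
  by rewrite addr0 opprB addrC addrA subrK zE opprD addrACA.
rewrite addr0 opprB addrC addrA subrK => /img_eq0/eqP.
by rewrite subr_eq0 => /eqP.
Qed.

Lemma phi_uniq e f c v w : indep2 e f -> f ** c = c -> c ** e = c ->
  img e v -> img f w -> img (e - c) (v - w) -> phi e c v = w.
Proof.
move=> ef fc ce ev fw gr; rewrite -[c]addr0 -[w]addr0.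
have i : indep3 e f 0.
  move=> x y z; rewrite !rmul0r addr0 => /eqP.
  rewrite addr_eq0 -rmulrN => /eqP xy; have ex := ef _ _ xy.
  by split=> //; apply/eqP; rewrite -oppr_eq0 -rmulrN -xy ex.
by apply: (phi_uniq2 i); rewrite ?rmul0r ?addr0 //; apply: img0.
Qed.

(** Composition of graphs: where (e - c) R + (f - d) R meets e R + g R, the f-component vanishes,
    and what remains lies in (e - d c) R. *)
Lemma phi_comp e f g c d v : indep3 e f g ->
  f ** c = c -> c ** e = c -> g ** d = d -> d ** f = d ->
  img e v -> phi f d (phi e c v) = phi e (d ** c) v.
Proof.
move=> i fc ce gd df ev; have [cw ecw] := phiP c ev.
have fw := phi_codom fc ev; have [du fdu] := phiP d fw.
have gu := phi_codom gd fw.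
symmetry; apply: (@phi_uniq e g) => //; rewrite ?rmulA ?gd -?rmulA ?ce //.
  exact: indep3_2 (indep3_swap (indep3_rot (indep3_rot i))).
have -> : v - phi f d (phi e c v) =
    (v - phi e c v) + (phi e c v - phi f d (phi e c v)) by rewrite addrA subrK.
apply: (img_meet _ ecw fdu ev (subspaceB (img0 g) gu)); last first.
  by rewrite addrA subrK sub0r.
move=> x y z t E; exists x; rewrite E.
have [] := @indep3_eq _ _ _ _ x (y - c ** x) (- (d ** y)) z 0 t i.
  rewrite rmulr0 addr0 -E !rmulBl rmulBr rmulrN !rmulA fc gd.
  by rewrite -!addrA; congr (_ + _); rewrite addrCA.
move=> <- fy <-; rewrite rmulBl rmulrN !rmulA gd; congr (_ - _).
move/eqP: fy; rewrite rmulr0 rmulBr rmulA fc subr_eq0 => /eqP fy.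
by rewrite -{1}df -rmulA fy rmulA.
Qed.

(** The difference of v and the right-hand side lies in the images of (e - c) R + g R and (e - d) R
    + f R, and these right ideals meet inside (e - (c + d)) R. *)
Lemma phi_block e f g c d v : indep3 e f g ->
  f ** c = c -> c ** e = c -> g ** d = d -> d ** e = d ->
  img e v -> phi e (c + d) v = phi e c v + phi e d v.
Proof.
move=> i fc ce gd de ev; have [_ ecw] := phiP c ev; have [_ edu] := phiP d ev.
have fw := phi_codom fc ev; have gu := phi_codom gd ev.
apply: (phi_uniq2 i) => //.
have -> : v - (phi e c v + phi e d v) = (v - phi e c v) + (0 - phi e d v).
  by rewrite sub0r opprD addrA.
apply: (img_meet _ ecw (subspaceB (img0 g) gu) edu (subspaceB (img0 f) fw)).
  move=> x y z t E; exists x; rewrite !rmulBl in E *.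
  have [] := @indep3_eq _ _ _ _ x (- (c ** x)) y z t (- (d ** z)) i.
    by rewrite !rmulrN !rmulA fc gd E addrAC.
  move=> exz _; rewrite rmulrN rmulA gd => ->.
  by rewrite rmulDl opprD addrA -{1}de -rmulA -exz rmulA de.
by rewrite !sub0r addrAC.
Qed.

(* The lattice-theoretic addition of von Staudt. *)
Lemma phi_shear e f g r s t v : indep3 e f g ->
  f ** r = r -> r ** e = r -> g ** t = t -> t ** e = t ->
  f ** s = s -> s ** g = s ->
  img e v -> phi e (r + s ** t) v = phi e r v + phi g s (phi e t v).
Proof.
move=> i fr re gt te fs sg ev.
have E1 := phi_block i fr re gt te ev.
have gw := phi_codom gt ev.
have [_ ert] := phiP (r + t) ev; rewrite E1 in ert.
have [_ gsw] := phiP s gw.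
have fw := phi_codom fr ev; have fu := phi_codom fs gw.
apply: (@phi_uniq e f) => //;
  rewrite ?rmulDr ?rmulDl ?rmulA ?fr ?fs ?re -?rmulA ?te //.
- exact: indep3_2 i.
- exact: subspaceD.
set w := phi e t v in ert gw gsw fu *.
(* The second summand, from the image of (g - s) R, cancels the g-component of the first. In R,
   cancelling it in (e - (r + t)) x takes (g - s) t x and leaves (e - (r + s t)) x. *)
have -> : v - (phi e r v + phi g s w) =
    (v - (phi e r v + w)) + (w - phi g s w).
  by rewrite !opprD !addrA subrK.
apply: (img_meet _ ert gsw ev (subspaceB (img0 f) (subspaceD fw fu))).
  move=> x y z u E; exists x; rewrite E.
  have [] := @indep3_eq _ _ _ _ x (- (r ** x) - s ** y) (y - t ** x) z u 0 i.
    rewrite rmulr0 addr0 -E !rmulBl rmulDl !rmulBr rmulrN !rmulA fr fs gt.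
    rewrite opprD -!addrA; congr (_ + (_ + _)).
    by rewrite [RHS]addrCA addrC -addrA.
  move=> <- <- gy; move/eqP: gy; rewrite rmulr0 !rmulBr rmulA gt subr_eq0.
  move=> /eqP gy; rewrite rmulBl rmulDl opprD rmulrN !rmulA fr fs.
  by rewrite -{1}sg -[s ** g ** y]rmulA gy rmulA.
by rewrite sub0r !opprD !addrA subrK.
Qed.


Lemma phi0 e v : img e v -> phi e 0 v = 0.
Proof. by move=> /(phiP 0)[/img_eq0]. Qed.

Lemma phiD e f c v w : indep2 e f -> f ** c = c -> c ** e = c ->
  img e v -> img e w -> phi e c (v + w) = phi e c v + phi e c w.
Proof.
move=> ef fc ce ev ew; apply: (phi_uniq ef) => //; first exact: subspaceD.
  by apply: subspaceD; apply: phi_codom.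
rewrite opprD addrACA; apply: subspaceD; first by case: (phiP c ev).
by case: (phiP c ew).
Qed.

Lemma phi_splitl e f f0 f1 c v : projection e -> e ** f0 = 0 -> e ** f1 = 0 ->
  projection f0 -> projection f1 -> f0 + f1 = f -> f0 ** f1 = 0 ->
  f ** c = c -> c ** e = c -> img e v ->
  phi e c v = phi e (f0 ** c) v + phi e (f1 ** c) v.
Proof.
move=> [ee _] ef0 ef1 [ff0 _] [ff1 _] fE f01 fc ce ev.
have {1}-> : c = f0 ** c + f1 ** c by rewrite -rmulDl fE.
apply: (@phi_block e f0 f1); rewrite ?rmulA ?ff0 ?ff1 -?rmulA ?ce //.
by apply: orth_indep3 => //; apply: orth_indep2.
Qed.

Lemma phi_splitr e f f0 f1 c v w : projection f -> f ** e = 0 ->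
  f0 + f1 = f -> f ** f0 = f0 -> f ** f1 = f1 ->
  e ** c = c -> c ** f = c -> img f0 v -> img f1 w ->
  phi f c (v + w) = phi f0 (c ** f0) v + phi f1 (c ** f1) w.
Proof.
move=> [ff _] fe fE ff0 ff1 ec cf v0 w1.
have ec0 a : e ** (c ** a) = c ** a by rewrite rmulA ec.
apply: (@phi_uniq f e) => //; first exact: orth_indep2.
- by apply: subspaceD; [apply: img_subl v0 | apply: img_subl w1].
- by apply: subspaceD; apply: phi_codom.
rewrite opprD addrACA; apply: subspaceD.
  have [_] := phiP (c ** f0) v0; apply: img_sub => x; exists (f0 ** x).
  by rewrite !rmulBl !rmulA ff0.
have [_] := phiP (c ** f1) w1; apply: img_sub => x; exists (f1 ** x).
by rewrite !rmulBl !rmulA ff1.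
Qed.

(* [s] in [e ** R ** e] acts through the isomorphic copy [h ** R] of [e ** R],
   since [phi e s] makes no sense when domain and codomain overlap. *)
Definition rho e h t t' s v := phi h t' (phi e (t ** s) v).

(** * Sums, products and adjoints of graph maps over e *)

Section Frame.
Variable e : R.
Hypothesis pe : projection e.

(** Equivalence of orthogonal projections: left multiplications by t and t' are inverse isomorphisms
    between e R and h R. *)
Definition iso_proj h t t' := [/\ projection h, e ** h = 0,
  h ** t = t /\ t ** e = t, e ** t' = t' /\ t' ** h = t' &
  t' ** t = e /\ t ** t' = h].

(** The two graphs agree up to exchanging domain and codomain: (e - t) x = - (h - t') t x. *)
Lemma phi_inv h t t' v : iso_proj h t t' -> img e v ->
  phi h t' (phi e t v) = v.
Proof.
move=> [ph eh [ht te] [et' t'h] [t't tt']] ev.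
have he := orthC pe ph eh; have [hh _] := ph.
have hw := phi_codom ht ev.
apply: (@phi_uniq h e) => //; first exact: orth_indep2.
rewrite -[_ - v]opprB -[- (v - _)]scaleN1r; apply: subspaceZ.
have [_] := phiP t ev; apply: img_sub => x; exists (- (t ** x)).
by rewrite rmulrN !rmulBl !rmulA ht t't opprB.
Qed.

(** Factoring d as (d t') t sends the second summand through h R, so that [phi_shear] applies. *)
Lemma phi_add_indep h t t' f c d v : iso_proj h t t' ->
  projection f -> e ** f = 0 -> indep2 f h ->
  f ** c = c -> c ** e = c -> f ** d = d -> d ** e = d -> img e v ->
  phi e (c + d) v = phi e c v + phi e d v.
Proof.
move=> [ph eh [ht te] [et' t'h] [t't tt']] pf ef fh fc ce fd de ev.
have [ee _] := pe; have [ff _] := pf.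
have i := orth_indep3 ee ef eh fh.
have dE : d ** t' ** t = d by rewrite -rmulA t't.
have ft' : f ** (d ** t') = d ** t' by rewrite rmulA fd.
have t'h' : d ** t' ** h = d ** t' by rewrite -rmulA t'h.
rewrite -{1}dE (phi_shear i) // (@phi_comp e h f) // ?dE //.
exact: indep3_swap (indep3_rot (indep3_rot i)).
Qed.

(** The map for t a b is the composite of those for b, a and t along e, f, e, h; [phi_inv] then
    undoes t. *)
Lemma rho_mul_indep h t t' f a b v : iso_proj h t t' ->
  projection f -> e ** f = 0 -> indep2 f h ->
  f ** b = b -> b ** e = b -> e ** a = a -> a ** f = a -> img e v ->
  rho e h t t' (a ** b) v = phi f a (phi e b v).
Proof.
move=> I pf ef fh fb be ea af ev; have [ph eh [ht te] [et' t'h] _] := I.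
have [ee _] := pe; have i := orth_indep3 ee ef eh fh.
have fw := phi_codom fb ev.
have hta : h ** (t ** a) = t ** a by rewrite rmulA ht.
have taf : t ** a ** f = t ** a by rewrite -rmulA af.
rewrite /rho rmulA -(phi_comp i) // -(phi_comp (indep3_swap i)) //.
by rewrite (phi_inv I) //; apply: phi_codom.
Qed.

Variables (h2 t2 t2' h3 t3 t3' : R).
Hypotheses (I2 : iso_proj h2 t2 t2') (I3 : iso_proj h3 t3 t3').
Hypothesis h23 : h2 ** h3 = 0.

(* [f1] can be handled with the copy [h2] of [e], and [f0 <= h2] with [h3]. *)
Lemma split_indep f : projection f -> e ** f = 0 ->
  exists f0 f1 : R, [/\ projection f0, projection f1, f0 + f1 = f &
    [/\ f0 ** f1 = 0, f ** f0 = f0, f ** f1 = f1 &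
    [/\ e ** f0 = 0, e ** f1 = 0, indep2 f0 h3 & indep2 f1 h2]]].
Proof.
move=> pf ef; have [ph2 _ _ _ _] := I2; have [ph3 _ _ _ _] := I3.
have [f0 [f1 [p0 p1 fE [ff0 f01 hf0 i1]]]] := projection_split pf ph2.
have [ff _] := pf; have [ff0' f0s] := p0.
have f1E : f1 = f - f0 by rewrite -fE [f0 + _]addrC addrK.
exists f0, f1; split=> //; split=> //.
  by rewrite f1E rmulBr ff ff0.
have ef0 : e ** f0 = 0 by rewrite -ff0 rmulA ef rmul0r.
split=> //; first by rewrite f1E rmulBr ef ef0 subrr.
apply: orth_indep2 => //; apply: (orthC ph3 p0).
by rewrite -hf0 rmulA (orthC ph2 ph3 h23) rmul0r.
Qed.

(** As f R may meet h2 R, f is split: the part in f0 is added through the copy h3 of e, the part in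
    f1 through h2. *)
Lemma phi_add f c d v : projection f -> e ** f = 0 ->
  f ** c = c -> c ** e = c -> f ** d = d -> d ** e = d -> img e v ->
  phi e (c + d) v = phi e c v + phi e d v.
Proof.
move=> pf ef fc ce fd de ev.
have [f0 [f1 [p0 p1 fE [f01 ff0 ff1 [ef0 ef1 i0 i1]]]]] := split_indep pf ef.
have split x : f ** x = x -> x ** e = x ->
    phi e x v = phi e (f0 ** x) v + phi e (f1 ** x) v.
  by move=> fx xe; apply: (phi_splitl pe ef0 ef1 p0 p1 fE f01 fx xe).
rewrite (split (c + d)) ?rmulDr ?rmulDl ?fc ?fd ?ce ?de //.
rewrite (split c fc ce) (split d fd de).
have [ff0' _] := p0; have [ff1' _] := p1.
rewrite (phi_add_indep I3 p0) // ?rmulA ?ff0' -?rmulA ?ce ?de //.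
rewrite (phi_add_indep I2 p1) // ?rmulA ?ff1' -?rmulA ?ce ?de //.
by rewrite addrACA.
Qed.

Lemma phi_opp f c v : projection f -> e ** f = 0 ->
  f ** c = c -> c ** e = c -> img e v -> phi e (- c) v = - phi e c v.
Proof.
move=> pf ef fc ce ev; apply/eqP; rewrite -addr_eq0 addrC.
by rewrite -(phi_add pf) // ?rmulrN ?rmulNr ?fc ?ce // subrr phi0.
Qed.

Let rho2 := rho e h2 t2 t2'.

Lemma rho_img s v : img e v -> img e (rho2 s v).
Proof.
move=> ev; have [_ _ [ht te] [et' t'h] _] := I2.
by apply: phi_codom => //; apply: phi_codom => //; rewrite rmulA ht.
Qed.

Lemma rho_add r s v : r ** e = r -> s ** e = s -> img e v ->
  rho2 (r + s) v = rho2 r v + rho2 s v.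
Proof.
move=> re se ev; have [ph eh [ht te] [et' t'h] _] := I2.
have hts x : h2 ** (t2 ** x) = t2 ** x by rewrite rmulA ht.
rewrite /rho2 /rho rmulDr (phi_add ph) // -?rmulA ?re ?se //.
have [hh _] := ph.
apply: (@phiD h2 e) => //; try by apply: phi_codom.
by apply: orth_indep2 => //; apply: (orthC pe).
Qed.

(** The choice of copy does not matter: s = t2' (t2 s) factors through h2 R, where [rho_mul_indep]
    can be used with the copy h3. *)
Lemma rho_frame s v : e ** s = s -> s ** e = s -> img e v ->
  rho2 s v = rho e h3 t3 t3' s v.
Proof.
move=> es se ev; have [ph eh [ht te] [et' t'h] [t't _]] := I2.
have [hh _] := ph.
rewrite /rho2 {1}/rho -(rho_mul_indep I3 ph) // ?rmulA ?ht ?t't ?es //.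
  exact: orth_indep2.
by rewrite -rmulA se.
Qed.

(** Both factors are split along f = f0 + f1. The product through f0 is computed with the copy h3
    and carried back to h2 by [rho_frame]. *)
Lemma rho_mul f a b v : projection f -> e ** f = 0 ->
  f ** b = b -> b ** e = b -> e ** a = a -> a ** f = a -> img e v ->
  rho2 (a ** b) v = phi f a (phi e b v).
Proof.
move=> pf ef fb be ea af ev.
have [f0 [f1 [p0 p1 fE [f01 ff0 ff1 [ef0 ef1 i0 i1]]]]] := split_indep pf ef.
have [ff0' _] := p0; have [ff1' _] := p1.
have f0b : f0 ** (f0 ** b) = f0 ** b by rewrite rmulA ff0'.
have f1b : f1 ** (f1 ** b) = f1 ** b by rewrite rmulA ff1'.
have fe := orthC pe pf ef.
rewrite (phi_splitl pe ef0 ef1 p0 p1 fE f01 fb) //.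
rewrite (phi_splitr pf fe fE) //; try exact: phi_codom.
have ae g : e ** (a ** g) = a ** g by rewrite rmulA ea.
have ag0 : a ** f0 ** f0 = a ** f0 by rewrite -rmulA ff0'.
have ag1 : a ** f1 ** f1 = a ** f1 by rewrite -rmulA ff1'.
have bg g : g ** b ** e = g ** b by rewrite -rmulA be.
have rE0 := rho_mul_indep I3 p0 ef0 i0 f0b (bg f0) (ae f0) ag0 ev.
have rE1 := rho_mul_indep I2 p1 ef1 i1 f1b (bg f1) (ae f1) ag1 ev.
have eab g : e ** (a ** (g ** b)) = a ** (g ** b) by rewrite rmulA ea.
have abe g : a ** (g ** b) ** e = a ** (g ** b) by rewrite -rmulA bg.
rewrite -rE0 -rE1 -!rmulA f0b f1b -(rho_frame (eab f0) (abe f0) ev).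
by rewrite -(rho_add (abe f0) (abe f1) ev) -rmulDr -rmulDl fE fb.
Qed.

(** The graphs (f - a) R and (e + star a) R are orthogonal. Since e R and f R are orthogonal too,
    expanding the form leaves just the two terms of the claim. *)
Lemma phi_adj f a v w : projection f -> e ** f = 0 ->
  e ** a = a -> a ** f = a -> img f w -> img e v ->
  B (phi f a w) v = B w (phi e (star a) v).
Proof.
move=> pf ef ea af fw ev; have [ff fs] := pf; have [ee es] := pe.
have fe := orthC pe pf ef.
have fsa : f ** star a = star a by rewrite -{1}fs -starM af.
have sae : star a ** e = star a by rewrite -{1}es -starM ea.
have [_ aw] := phiP a fw; have [_ av] := phiP (- star a) ev.
rewrite (phi_opp pf) // !opprK in av.
have w1 := phi_codom ea fw; have v1 := phi_codom fsa ev.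
have sef : star e ** f = 0 by rewrite es.
have sfe : star f ** e = 0 by rewrite fs.
have := @img_orth (f - a) (e + star a) _ _ _ aw av.
have aa0 : star a ** star a = 0.
  by rewrite -{1}sae -fsa rmulA -[_ ** e ** f]rmulA ef rmulr0 rmul0r.
rewrite starB fs rmulBl !rmulDr fe fsa sae aa0 add0r addr0 subrr => /(_ erefl).
rewrite formBl !form_addr (img_orth sfe fw ev) (img_orth sef w1 v1).
by rewrite add0r addr0 => /eqP; rewrite subr_eq0 => /eqP.
Qed.

Lemma phi_adjr f a v w : projection f -> e ** f = 0 ->
  f ** a = a -> a ** e = a -> img f w -> img e v ->
  B (phi e a v) w = B v (phi f (star a) w).
Proof.
move=> pf ef fa ae fw ev; have [_ fs] := pf; have [_ es] := pe.
rewrite form_hermitian -{1}[a]starK -(phi_adj pf) ?starK -?form_hermitian //.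
  by rewrite -{1}es -starM ae.
by rewrite -{1}fs -starM fa.
Qed.

(** Both graph maps in [rho2 s] are moved across the form, and [rho_mul] with f = h2 joins them
    again, [star (t2 ** s) ** star t2'] being [star s]. *)
Lemma rho_adj s v w : e ** s = s -> s ** e = s -> img e v -> img e w ->
  B (rho2 s v) w = B v (rho2 (star s) w).
Proof.
move=> es se ev ew; have [_ ee] := pe.
have [ph eh [ht te] [et' t'h] [t't _]] := I2; have [_ hs] := ph.
have hts : h2 ** (t2 ** s) = t2 ** s by rewrite rmulA ht.
have tse : t2 ** s ** e = t2 ** s by rewrite -rmulA se.
have hw : img h2 (phi e (star t2') w).
  by apply: phi_codom; rewrite // -{1}hs -starM t'h.
rewrite {1}/rho2 /rho (phi_adj ph) //; last exact: phi_codom.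
rewrite (phi_adjr ph) // -rho_mul // -?starM.
- by rewrite rmulA t't es.
- by rewrite -{1}hs -starM t'h.
- by rewrite -{1}ee -starM et'.
- by rewrite -{1}ee -starM tse.
- by rewrite -{1}hs -starM hts.
Qed.

Lemma rho_comp r s v : e ** r = r -> r ** e = r -> e ** s = s -> s ** e = s ->
  img e v -> rho2 r (rho2 s v) = rho2 (r ** s) v.
Proof.
move=> er re es se ev.
have [ph2 eh2 [ht2 te2] [et2 th2] _] := I2.
have [ph3 eh3 [ht3 te3] [et3 th3] [t3t _]] := I3.
have [hh3 _] := ph3; have [ee _] := pe.
have i : indep3 e h3 h2.
  by apply: orth_indep3 => //; apply: orth_indep2 => //; apply: orthC h23.
have h2r : h2 ** (t2 ** r) = t2 ** r by rewrite rmulA ht2.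
have re2 : t2 ** r ** e = t2 ** r by rewrite -rmulA re.
have hts : h3 ** (t3 ** s) = t3 ** s by rewrite rmulA ht3.
have tse : t3 ** s ** e = t3 ** s by rewrite -rmulA se.
(* With the inner factor on the copy h3, the path e, h3, e, h2 composes; a passage from h2 through e
   back to h2 would not have independent ends. *)
rewrite (rho_frame es se ev) /rho2 /rho.
rewrite (phi_comp (indep3_swap i)) //; last exact: phi_codom.
rewrite (phi_comp i) //; first by rewrite -!rmulA [t3' ** _]rmulA t3t es.
  by rewrite rmulA h2r.
by rewrite -rmulA th3.
Qed.

(** * The maps T_x, written [gen x], and the action of R on their span *)

Definition gen x v := rho2 (e ** x) v + phi e (x - e ** x) v.

Lemma off_diag x : x ** e = x ->
  e ** (x - e ** x) = 0 /\ (x - e ** x) ** e = x - e ** x.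
Proof.
by move=> xe; have [ee _] := pe; rewrite rmulBr rmulA ee subrr rmulBl -rmulA xe.
Qed.

Lemma genD x y v : x ** e = x -> y ** e = y -> img e v ->
  gen (x + y) v = gen x v + gen y v.
Proof.
move=> xe ye ev; have [ex xe'] := off_diag xe; have [ey ye'] := off_diag ye.
have [f pf [fx fy ef]] := orth_range2 pe ex ey.
rewrite /gen rmulDr rho_add -?rmulA ?xe ?ye // opprD [x + y + _]addrACA.
by rewrite (phi_add pf ef fx xe' fy ye' ev) addrACA.
Qed.

(** The cross terms vanish, as e R and f R are orthogonal. The other two come from
    [star (e ** x) ** (e ** y)] and [star (x - e ** x) ** (y - e ** y)], whose sum is
    [star x ** y]. *)
Lemma gen_form x y v w : x ** e = x -> y ** e = y -> img e v -> img e w ->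
  B (gen x v) (gen y w) = B v (rho2 (star x ** y) w).
Proof.
move=> xe ye ev ew; have [ee es] := pe.
have [ex xe'] := off_diag xe; have [ey ye'] := off_diag ye.
have [f pf [fx fy ef]] := orth_range2 pe ex ey.
have [_ fs] := pf.
have sef : star e ** f = 0 by rewrite es.
have sfe : star f ** e = 0 by rewrite fs (orthC pe).
have fv := phi_codom fx ev; have fw := phi_codom fy ew.
rewrite /gen form_addl !form_addr (img_orth sef (rho_img _ ev) fw).
rewrite (img_orth sfe fv (rho_img _ ew)) addr0 add0r.
have exl z : e ** (e ** z) = e ** z by rewrite rmulA ee.
have exr z : z ** e = z -> e ** z ** e = e ** z by move=> ze; rewrite -rmulA ze.
have sl z : z ** e = z -> e ** star z = star z.
  by move=> ze; rewrite -{1}es -starM ze.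
have sr z : e ** z = z -> star z ** e = star z.
  by move=> ez; rewrite -{1}es -starM ez.
rewrite (rho_adj (exl x) (exr x xe) ev (rho_img _ ew)).
rewrite (rho_comp (sl _ (exr x xe)) (sr _ (exl x)) (exl y) (exr y ye) ew).
rewrite (phi_adjr pf ef fx xe' fw ev).
have sfx : star (x - e ** x) ** f = star (x - e ** x).
  by rewrite -{1}fs -starM fx.
rewrite -(rho_mul pf ef fy ye' (sl _ xe') sfx ew).
rewrite -form_addr -rho_add -?rmulA ?ye' ?ye //.
rewrite starM starB starM es rmulBl -!rmulA exl.
rewrite [e ** (y - _)]rmulBr exl subrr rmulr0 subr0 -rmulDr.
by rewrite addrC subrK.
Qed.

Lemma img_le a b : injective iota -> (forall v, img a v -> img b v) ->
  (pideal a <= pideal b)%O.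
Proof.
case: rep => hI _ _ _ inj ab; apply/meet_idPl/inj.
by rewrite hI; apply/meet_idPl/asboolP.
Qed.

Lemma gen_inj x : injective iota -> x ** e = x ->
  (forall v, img e v -> gen x v = 0) -> x = 0.
Proof.
move=> inj xe x0; have [ee es] := pe.
have [ph eh [ht te] [et' t'h] [t't tt']] := I2; have [hh _] := ph.
have he := orthC pe ph eh.
have [c cE] : exists c, c = t2 ** (star x ** x) by eexists.
have esx : e ** star x = star x by rewrite -{1}es -starM xe.
(* By [gen_form], pairing this vector with itself is a pairing of values of [gen x], hence 0. *)
have r0 v : img e v -> rho2 (star x ** x) v = 0.
  move=> ev; apply: (@form_anisotropic _ _ B).
  rewrite -(gen_form xe xe) //; last exact: rho_img.
  by rewrite (x0 v ev) form0r.
have hc : h2 ** c = c by rewrite cE rmulA ht.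
(* The map [phi h2 t2'] has kernel 0, because (h2 - t2') R and h2 R meet in 0. *)
have c0 v : img e v -> phi e c v = 0.
  move=> ev; have hv := phi_codom hc ev; rewrite cE in hv *.
  have [_] := phiP t2' hv; rewrite [phi h2 _ _](r0 _ ev) subr0.
  move=> tv; apply: (img_meet0 _ tv hv) => y z.
  rewrite rmulBl => E.
  have t'y : t2' ** y = 0.
    by rewrite -et' -rmulA; move/(congr1 (rmul e)): E;
      rewrite rmulBr !rmulA eh !rmul0r sub0r => /eqP; rewrite oppr_eq0 => /eqP.
  by rewrite t'y -tt' -rmulA t'y rmulr0 subr0.
(* As [phi e c] vanishes, (e - c) R contains e R, so e = (e - c) k. Multiplication by h2 gives c k =
   0, whence e = e k and c = c e k = 0. *)
have /asboolP : (pideal e <= pideal (e - c))%O.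
  apply: img_le => // v ev; have [_] := phiP c ev.
  by rewrite (c0 v ev) subr0.
move=> /(_ e); case; first by exists e.
move=> k ek.
have ck : c ** k = 0.
  move/(congr1 (rmul h2)): ek; rewrite he rmulBl rmulBr !rmulA he hc.
  by rewrite rmul0r sub0r => /esym/eqP; rewrite oppr_eq0 => /eqP.
have ekE : e = e ** k by rewrite {1}ek rmulBl ck subr0.
have ce : c ** e = c by rewrite cE -!rmulA xe.
have c0' : c = 0 by rewrite -ce ekE rmulA ce ck.
apply: star_proper'; rewrite -esx -rmulA -t't -rmulA.
by rewrite -cE c0' rmulr0.
Qed.

(* [act w k]: [w] lies in the span of the [gen x v], and [k r] is [r] applied to
   [w] according to one way of writing [w] as a combination of generators. *)
Inductive act : V -> (R -> V) -> Prop :=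
| act_gen x v : x ** e = x -> img e v ->
    act (gen x v) (fun r => gen (r ** x) v)
| act0 : act 0 (fun _ => 0)
| actD w w' k k' : act w k -> act w' k' -> act (w + w') (fun r => k r + k' r)
| actZ (a : D^c) w k : act w k -> act (a *: w) (fun r => a *: k r).

(** On generators this is [gen_form] with [star (r ** x) ** y = star x ** (star r ** y)]; the rest
    is linearity in each argument. *)
Lemma act_adj w w' k k' : act w k -> act w' k' ->
  forall r, B (k r) w' = B w (k' (star r)).
Proof.
have formZl (a : D^c) u u' : B (a *: u) u' = dstar a * B u u'.
  by rewrite -[u' in LHS]scale1r form_sesqui mulr1.
have form1 u u' : B u u' = dstar 1 * B u u'.
  by rewrite -formZl scale1r.
have formZr (a : D^c) u u' : B u (a *: u') = B u u' * a.
  by rewrite -[u in LHS]scale1r form_sesqui -form1.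
move=> ak; elim: ak w' k' => {w k} [x v xe ev|||] w1.
- move=> k1; elim=> [y w ye ew||{}w1 w2 {}k1 k2 _ IH1 _ IH2|a {}w1 {}k1 _ IH] r.
  + by rewrite !gen_form -?rmulA ?xe ?ye // starM rmulA.
  + by rewrite !form0r.
  + by rewrite !form_addr IH1 IH2.
  + by rewrite !formZr IH.
- by move=> *; rewrite !form0l.
- move=> w2 k1 k2 _ IH1 _ IH2 w' k' a' r.
  by rewrite !form_addl (IH1 _ _ a') (IH2 _ _ a').
- by move=> w k _ IH w' k' a' r; rewrite !formZl (IH _ _ a').
Qed.

(** Yields both the invariance of the span and the multiplicativity of the action. *)
Lemma act_stable w k r : act w k -> act (k r) (fun s => k (s ** r)).
Proof.
elim=> [x v xe ev||w1 w2 k1 k2 _ IH1 _ IH2|a w1 k1 _ IH].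
- under eq_fun do rewrite -rmulA.
  by apply: act_gen => //; rewrite -rmulA xe.
- exact: act0.
- exact: (actD IH1 IH2).
- exact: (actZ a IH).
Qed.

(** The difference of the two values at r lies in the span itself, so by [act_adj] it is orthogonal
    to itself. *)
Lemma act_uniq w k k' : act w k -> act w k' -> k = k'.
Proof.
move=> a a'; apply/funext => r; apply/eqP; rewrite -subr_eq0; apply/eqP.
apply: (@form_anisotropic _ _ B).
have := actD (act_stable r a) (actZ (-1) (act_stable r a')).
rewrite scaleN1r; move: (fun s => _) => d ad.
by rewrite formBl (act_adj a ad) (act_adj a' ad) subrr.
Qed.

Lemma act_add w k r s : act w k -> k (r + s) = k r + k s.
Proof.
elim=> [x v xe ev||w1 w2 k1 k2 _ IH1 _ IH2|a w1 k1 _ IH].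
- by rewrite rmulDl genD // -rmulA xe.
- by rewrite addr0.
- by rewrite IH1 IH2 addrACA.
- by rewrite IH scalerDr.
Qed.

Lemma act_in0 : exists k, act 0 k.
Proof. by exists (fun _ => 0); exact: act0. Qed.

Lemma act_inD v w : (exists k, act v k) -> (exists k, act w k) ->
  exists k, act (v + w) k.
Proof. by move=> [k ak] [l al]; exists (fun r => k r + l r); apply: actD. Qed.
Lemma act_inZ (a : D^c) v : (exists k, act v k) -> exists k, act (a *: v) k.
Proof. by move=> [k ak]; exists (fun r => a *: k r); apply: actZ. Qed.

Definition act_space : subspace V :=
  @Subspace _ V (fun w => exists k, act w k) act_in0 act_inD act_inZ.

End Frame.
End Graphs.

(** * Subspaces as vector spaces with the restricted form *)

Section SubspaceType.
Variables (K : nzRingType) (V : lmodType K) (U : subspace V).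

Definition subspace_mem : {pred V} := fun v => `[< U v >].

Fact subspace_mem_closed : submod_closed subspace_mem.
Proof.
split; first by apply/asboolP; apply: subspace0.
by move=> a u v /asboolP Uu /asboolP Uv; apply/asboolP;
  apply: subspaceD => //; apply: subspaceZ.
Qed.

HB.instance Definition _ :=
  GRing.isSubmodClosed.Build K V subspace_mem subspace_mem_closed.

Record subspace_type := SubspaceType {
  subspace_val :> V; _ : subspace_val \in subspace_mem }.

HB.instance Definition _ := [isSub for subspace_val].
HB.instance Definition _ := [Choice of subspace_type by <:].
HB.instance Definition _ := [SubChoice_isSubLmodule of subspace_type by <:].

Lemma subspace_valP (u : subspace_type) : U u.
Proof. by case: u => u /= /asboolP. Qed.

Definition to_subspace v (Uv : U v) : subspace_type :=
  SubspaceType (asboolT Uv).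

End SubspaceType.

Section SubspaceForm.
Variables (D : starSkewFieldType) (V : lmodType D^c) (B : scalar_product V).
Variable U : subspace V.

Program Definition subspace_form : scalar_product (subspace_type U) :=
  @ScalarProduct D (subspace_type U) (fun v w => B (val v) (val w)) _ _ _ _ _.
Next Obligation. by move=> u v w /=; rewrite form_addl. Qed.
Next Obligation. by move=> u v w /=; rewrite form_addr. Qed.
Next Obligation. by move=> a b v w /=; rewrite form_sesqui. Qed.
Next Obligation. by move=> v w /=; apply: form_hermitian. Qed.
Next Obligation. by move=> v /= /form_anisotropic v0; apply: val_inj. Qed.

End SubspaceForm.

(** * The faithful representation on the span *)

Section FrameRepresentation.
Variables (R : starRegType) (D : starSkewFieldType) (V : lmodType D^c).
Variables (B : scalar_product V) (iota : Lbar R -> subspace V).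
Hypothesis rep : sectional_MOL_rep B iota.
Hypothesis iota_inj : injective iota.
Variables (e h2 t2 t2' h3 t3 t3' : R).
Hypothesis pe : projection e.
Hypotheses (I2 : iso_proj e h2 t2 t2') (I3 : iso_proj e h3 t3 t3').
Hypothesis h23 : h2 ** h3 = 0.
Hypothesis faithful : forall r : R, (forall x, r ** x ** e = 0) -> r = 0.

Let U := act_space iota e h2 t2 t2'.
Let W := subspace_type U.
Let actU := act iota e h2 t2 t2'.

(** An arbitrary choice, made harmless by [act_uniq]. *)
Let kfun (w : W) : R -> V := projT1 (cid (subspace_valP w)).

Let kfunP (w : W) : actU (val w) (kfun w).
Proof. exact: projT2 (cid (subspace_valP w)). Qed.

Let kfun_in w r : U (kfun w r).
Proof. by eexists; apply: (act_stable r (kfunP w)). Qed.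

Let actor (r : R) (w : W) : W := to_subspace (kfun_in w r).

Let actor_val w k r : actU (val w) k -> val (actor r w) = k r.
Proof.
by move=> ak; rewrite -(act_uniq rep pe I2 I3 h23 (kfunP w) ak).
Qed.

Fact actor_linear r : linear (actor r).
Proof.
move=> a v w; apply: val_inj.
exact: (@actor_val (a *: v + w) _ r (actD (actZ a (kfunP v)) (kfunP w))).
Qed.

HB.instance Definition _ r :=
  GRing.isLinear.Build D^c W W *:%R (actor r) (actor_linear r).

Lemma frame_linear_rep : has_faithful_linear_rep R.
Proof.
exists D, W, (subspace_form B U), (fun r => actor r : {linear W -> W}).
split.
  split=> [r s v|r s v|r v w].
  - by apply: val_inj; rewrite /= (act_add rep pe I2 I3 h23 _ _ (kfunP v)).
  - apply: val_inj.
    by rewrite (@actor_val (actor s v) _ r (act_stable s (kfunP v))).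
  - by rewrite /= (act_adj rep pe I2 I3 h23 (kfunP v) (kfunP w)).
move=> r s rs; apply/eqP; rewrite -subr_eq0; apply/eqP/faithful => x.
have [ee _] := pe; have xee : x ** e ** e = x ** e by rewrite -rmulA ee.
(* Since r and s agree on [gen (x ** e) v], the map T of (r - s) x e is zero. *)
rewrite -rmulA; apply: (gen_inj rep pe I2 I3 h23 iota_inj).
  by rewrite -rmulA xee.
move=> v ev; have ak := @act_gen _ _ _ iota e h2 t2 t2' _ _ xee ev.
have Uv : U (gen iota e h2 t2 t2' (x ** e) v) by eexists; apply: ak.
have rsv : actor r (to_subspace Uv) = actor s (to_subspace Uv).
  exact: (f_equal (fun f => f (to_subspace Uv)) rs).
have := congr1 val rsv; rewrite !(@actor_val (to_subspace Uv) _ _ ak) => E.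
apply: (addIr (gen iota e h2 t2 t2' (s ** (x ** e)) v)).
by have := act_add rep pe I2 I3 h23 (r - s) s ak; rewrite subrK E add0r.
Qed.

End FrameRepresentation.

(** * The skew field e R e of a minimal projection and its vector space R e *)

Section Corner.
Variable R : starRegType.

Record minimal_projection := MinimalProjection {
  minproj : R;
  minprojP : projection minproj;
  minproj_neq0 : minproj != 0;
  minproj_min : forall p : R, projection p -> minproj ** p = p ->
    p = 0 \/ p = minproj
}.

Variable m : minimal_projection.
Local Notation e := (minproj m).

Let ee : e ** e = e. Proof. by case: (minprojP m). Qed.
Let es : star e = e. Proof. by case: (minprojP m). Qed.

Definition corner_mem : {pred R} := fun x => e ** x ** e == x.

Fact corner_mem_closed : zmod_closed corner_mem.
Proof.
split; first by rewrite /corner_mem unfold_in rmulr0 rmul0r.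
move=> x y; rewrite !unfold_in => /eqP xE /eqP yE.
by rewrite rmulBr rmulBl xE yE.
Qed.

HB.instance Definition _ := GRing.isZmodClosed.Build R corner_mem
  corner_mem_closed.

Record corner := Corner { corner_val : R; _ : corner_val \in corner_mem }.

HB.instance Definition _ := [isSub for corner_val].
HB.instance Definition _ := [Choice of corner by <:].
HB.instance Definition _ := [SubChoice_isSubZmodule of corner by <:].

Lemma cornerl x : e ** corner_val x = corner_val x.
Proof. by case: x => x /= /eqP <-; rewrite !rmulA ee. Qed.
Lemma cornerr x : corner_val x ** e = corner_val x.
Proof. by case: x => x /= /eqP <-; rewrite -!rmulA ee. Qed.

Fact corner_in (x : R) : e ** x = x -> x ** e = x -> x \in corner_mem.
Proof. by move=> ex xe; rewrite unfold_in ex xe. Qed.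

Definition mk_corner x ex xe : corner := Corner (@corner_in x ex xe).

Program Definition corner_one := @mk_corner e _ _.
Next Obligation. exact: ee. Qed.
Next Obligation. exact: ee. Qed.
Program Definition corner_mul (x y : corner) :=
  @mk_corner (corner_val x ** corner_val y) _ _.
Next Obligation. by move=> x y; rewrite rmulA cornerl. Qed.
Next Obligation. by move=> x y; rewrite -rmulA cornerr. Qed.
Program Definition corner_star (x : corner) :=
  @mk_corner (star (corner_val x)) _ _.
Next Obligation. by move=> x; rewrite -{1}es -starM cornerr. Qed.
Next Obligation. by move=> x; rewrite -{1}es -starM cornerl. Qed.

Fact corner_mulA : associative corner_mul.
Proof. by move=> x y z; apply: val_inj; rewrite /= rmulA. Qed.
Fact corner_mul1x : left_id corner_one corner_mul.
Proof. by move=> x; apply: val_inj; rewrite /= cornerl. Qed.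
Fact corner_mulx1 : right_id corner_one corner_mul.
Proof. by move=> x; apply: val_inj; rewrite /= cornerr. Qed.
Fact corner_mulDl : left_distributive corner_mul +%R.
Proof. by move=> x y z; apply: val_inj; rewrite /= rmulDl. Qed.
Fact corner_mulDr : right_distributive corner_mul +%R.
Proof. by move=> x y z; apply: val_inj; rewrite /= rmulDr. Qed.
Fact corner_1neq0 : corner_one != 0.
Proof. exact: minproj_neq0. Qed.

HB.instance Definition _ := GRing.Zmodule_isNzRing.Build corner
  corner_mulA corner_mul1x corner_mulx1 corner_mulDl corner_mulDr corner_1neq0.

(** The range projection of x is nonzero and below e, hence equal to e by minimality. So e = x y,
    and y is compressed to e y e. *)
Lemma corner_rinv (x : corner) : x != 0 -> exists y, x * y = 1.
Proof.
move=> x0; have [p pp [px [y py] _]] := projection_range (corner_val x).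
have [|p0|pE] := minproj_min pp (_ : e ** p = p).
- by rewrite py rmulA cornerl.
- by case/eqP: x0; apply: val_inj; rewrite /= -px p0 rmul0r.
have ey : e ** (e ** y ** e) = e ** y ** e by rewrite !rmulA ee.
have ye : e ** y ** e ** e = e ** y ** e by rewrite -rmulA ee.
exists (mk_corner ey ye); apply: val_inj.
by rewrite /= !rmulA cornerr -py pE ee.
Qed.

(** Right inverses suffice: x y = 1 and y z = 1 force x = z. The value 0 at 0 follows the convention
    that a non-unit is its own inverse. *)
Lemma corner_inv_ex (x : corner) :
  exists y, if x == 0 then y = 0 else y * x = 1 /\ x * y = 1.
Proof.
have [_|x0] := eqVneq x 0; first by exists 0.
have [y xy] := corner_rinv x0; exists y; split=> //.
have y0 : y != 0.
  by apply/eqP => y0; move/eqP: xy; rewrite y0 mulr0 eq_sym oner_eq0.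
have [z yz] := corner_rinv y0.
suff -> : x = z by [].
by rewrite -[x]mulr1 -yz mulrA xy mul1r.
Qed.

Definition corner_inv (x : corner) : corner := projT1 (cid (corner_inv_ex x)).

Fact corner_mulVr : {in [pred x : corner | x != 0],
  left_inverse 1 corner_inv *%R}.
Proof.
move=> x; rewrite inE /corner_inv; case: cid => y /=.
by case: eqVneq => // _ [].
Qed.
Fact corner_mulrV : {in [pred x : corner | x != 0],
  right_inverse 1 corner_inv *%R}.
Proof.
move=> x; rewrite inE /corner_inv; case: cid => y /=.
by case: eqVneq => // _ [].
Qed.
Fact corner_unitP (x y : corner) : y * x = 1 /\ x * y = 1 ->
  x \in [pred x : corner | x != 0].
Proof.
move=> [yx _]; rewrite inE; apply/eqP => x0.
by move/eqP: yx; rewrite x0 mulr0 eq_sym oner_eq0.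
Qed.
Fact corner_inv_out :
  {in [predC [pred x : corner | x != 0]], corner_inv =1 id}.
Proof.
move=> x; rewrite !inE negbK /corner_inv; case: cid => y /=.
by case: eqVneq => // ->.
Qed.

HB.instance Definition _ := GRing.NzRing_hasMulInverse.Build corner
  corner_mulVr corner_mulrV corner_unitP corner_inv_out.

Fact corner_skew (x : corner) : x != 0 -> x \is a GRing.unit.
Proof. by []. Qed.
Fact corner_starD : {morph corner_star : x y / x + y}.
Proof. by move=> x y; apply: val_inj; rewrite /= starD. Qed.
Fact corner_starM (x y : corner) :
  corner_star (x * y) = corner_star y * corner_star x.
Proof. by apply: val_inj; rewrite /= starM. Qed.
Fact corner_starK : involutive corner_star.
Proof. by move=> x; apply: val_inj; rewrite /= starK. Qed.

HB.instance Definition _ := UnitRing_isStarSkewField.Build corner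
  corner_skew corner_starD corner_starM corner_starK.

Definition lideal_mem : {pred R} := fun x => x ** e == x.

Fact lideal_mem_closed : zmod_closed lideal_mem.
Proof.
split; first by rewrite unfold_in rmul0r.
by move=> x y; rewrite !unfold_in => /eqP xE /eqP yE; rewrite rmulBl xE yE.
Qed.

HB.instance Definition _ := GRing.isZmodClosed.Build R lideal_mem
  lideal_mem_closed.

Record lideal := LIdeal { lideal_val : R; _ : lideal_val \in lideal_mem }.

HB.instance Definition _ := [isSub for lideal_val].
HB.instance Definition _ := [Choice of lideal by <:].
HB.instance Definition _ := [SubChoice_isSubZmodule of lideal by <:].

Lemma lidealr x : lideal_val x ** e = lideal_val x.
Proof. by case: x => x /= /eqP. Qed.

Definition mk_lideal (x : R) (xe : x ** e = x) : lideal :=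
  @LIdeal x (introT eqP xe).

Program Definition lideal_scale (a : corner^c) (x : lideal) :=
  @mk_lideal (lideal_val x ** corner_val a) _.
Next Obligation. by move=> a x; rewrite -rmulA cornerr. Qed.

Fact lideal_scaleA a b x :
  lideal_scale a (lideal_scale b x) = lideal_scale (a * b) x.
Proof. by apply: val_inj; rewrite /= rmulA. Qed.
Fact lideal_scale1 : left_id 1 lideal_scale.
Proof. by move=> x; apply: val_inj; rewrite /= lidealr. Qed.
Fact lideal_scaleDr : right_distributive lideal_scale +%R.
Proof. by move=> a x y; apply: val_inj; rewrite /= rmulDl. Qed.
Fact lideal_scaleDl x : {morph lideal_scale^~ x : a b / a + b}.
Proof. by move=> a b; apply: val_inj; rewrite /= rmulDr. Qed.

HB.instance Definition _ := GRing.Zmodule_isLmodule.Build corner^c lideal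
  lideal_scaleA lideal_scale1 lideal_scaleDr lideal_scaleDl.

Program Definition lideal_prod (x y : lideal) : corner :=
  @mk_corner (star (lideal_val x) ** lideal_val y) _ _.
Next Obligation. by move=> x y; rewrite -{1}es rmulA -starM lidealr. Qed.
Next Obligation. by move=> x y; rewrite -rmulA lidealr. Qed.

Program Definition lideal_form : scalar_product lideal :=
  @ScalarProduct corner lideal lideal_prod _ _ _ _ _.
Next Obligation. by move=> x y z; apply: val_inj; rewrite /= starD rmulDl. Qed.
Next Obligation. by move=> x y z; apply: val_inj; rewrite /= rmulDr. Qed.
Next Obligation.
by move=> a b x y; apply: val_inj; rewrite /= starM !rmulA.
Qed.
Next Obligation. by move=> x y; apply: val_inj; rewrite /= starM starK. Qed.
Next Obligation.
by move=> x /(congr1 val) /= /star_proper' x0; apply: val_inj.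
Qed.

Program Definition lideal_act (r : R) (x : lideal) : lideal :=
  @mk_lideal (r ** lideal_val x) _.
Next Obligation. by move=> r x; rewrite -rmulA lidealr. Qed.

Fact lideal_act_linear r : linear (lideal_act r).
Proof. by move=> a x y; apply: val_inj; rewrite /= rmulDr rmulA. Qed.

HB.instance Definition _ r := GRing.isLinear.Build corner^c lideal lideal *:%R
  (lideal_act r) (lideal_act_linear r).

Lemma minimal_linear_rep :
  (forall r : R, (forall x, r ** x ** e = 0) -> r = 0) ->
  has_faithful_linear_rep R.
Proof.
move=> faithful.
exists corner, lideal, lideal_form,
  (fun r => lideal_act r : {linear lideal -> lideal}); split.
  split=> [r s x|r s x|r x y].
  - by apply: val_inj; rewrite /= rmulDl.
  - by apply: val_inj; rewrite /= rmulA.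
  - by apply: val_inj; rewrite /= starM rmulA.
move=> r s rs; apply/eqP; rewrite -subr_eq0; apply/eqP/faithful => x.
have xee : x ** e ** e = x ** e by rewrite -rmulA ee.
have /(congr1 val) /= E :
    lideal_act r (mk_lideal xee) = lideal_act s (mk_lideal xee).
  exact: (f_equal (fun f => f (mk_lideal xee)) rs).
by rewrite -rmulA rmulBl E subrr.
Qed.

End Corner.

(** * Finding a minimal projection or a frame in the smallest ideal *)

Section SubdirectlyIrreducible.
Variable R : starRegType.

(* The annihilator of [R ** e] is an ideal not containing [e]. *)
Lemma monolith_faithful (I : set R) (e : R) :
  (forall J : set R, nonzero_ideal J -> (I `<=` J)%classic) ->
  I e -> projection e -> e != 0 ->
  forall r : R, (forall x, r ** x ** e = 0) -> r = 0.
Proof.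
move=> Imin Ie [ee _] e0 r re; apply/eqP; apply: contraNT e0 => r0.
have /(_ e Ie e) : (I `<=` [set r | forall x, r ** x ** e = 0%R])%classic.
  apply: Imin; split; last by exists r.
  split=> [x|x y xe ye z|s x xe]; first by rewrite !rmul0r.
    by rewrite !rmulBl xe ye subrr.
  by split=> z; [rewrite -!rmulA [x ** _]rmulA xe rmulr0 | rewrite -(rmulA x) xe].
by rewrite !ee => ->.
Qed.

(** Here p and q are the left and right projections of a, and b is its Moore-Penrose inverse. *)
Lemma range_iso (a : R) : exists p q b : R, [/\ projection p, projection q,
  p ** a = a /\ a ** q = a, q ** b = b /\ b ** p = b &
  [/\ a ** b = p, b ** a = q, exists y, p = a ** y & exists z, q = z ** a]].
Proof.
have [p pp [pa [y py] _]] := projection_range a.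
have [q pq [qa [z qz] _]] := projection_range (star a).
have [ppp _] := pp; have [qqq qs] := pq.
have aq : a ** q = a by rewrite -{1}[a]starK -qs -starM qa starK.
have qz' : q = star z ** a by rewrite -qs qz starM starK.
exists p, q, (q ** y ** p); split=> //.
  by split; [rewrite !rmulA qqq | rewrite -(rmulA _ p p) ppp].
split; [by rewrite !rmulA aq -py ppp| |by exists y|by exists (star z)].
by rewrite -(rmulA _ p a) pa qz' -!rmulA [a ** (y ** a)]rmulA -py pa.
Qed.

Lemma frame_exists (I : set R) (p1 p2 p3 : R) :
  (forall J : set R, nonzero_ideal J -> (I `<=` J)%classic) ->
  two_sided_ideal I ->
  projection p1 -> projection p2 -> projection p3 ->
  I p1 -> p1 != 0 -> p2 != 0 -> p3 != 0 ->
  p1 ** p2 = 0 -> p1 ** p3 = 0 -> p2 ** p3 = 0 ->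
  exists e h2 t2 t2' h3 t3 t3' : R, [/\ projection e, I e /\ e != 0,
    iso_proj e h2 t2 t2', iso_proj e h3 t3 t3' & h2 ** h3 = 0].
Proof.
move=> Imin [_ _ II] pp1 pp2 pp3 I1 n1 n2 n3 p12 p13 p23.
(* If q R p were 0, then q would annihilate R p, on which R acts faithfully. *)
have link p q : I p -> projection p -> p != 0 -> projection q -> q != 0 ->
    exists a, [/\ a != 0, q ** a = a & a ** p = a].
  move=> Ip pp p0 [qq _]; apply: contra_neqP => /forallNP q0.
  apply: (monolith_faithful Imin Ip) => // x; apply/eqP/negPn/negP => qxp.
  have [ppp _] := pp.
  by apply: (q0 (q ** x ** p)); split; rewrite // ?rmulA ?qq // -(rmulA _ p p) ppp.
have [a [a0 p2a ap1]] := link _ _ I1 pp1 n1 pp2 n2.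
have := range_iso a.
move=> [q2 [q1 [b [pq2 pq1 [q2a aq1] [q1b bq2] [ab ba [y q2y] [z q1z]]]]]].
have [pp11 ps1] := pp1; have [qq1 qs1] := pq1.
have q1p1 : q1 ** p1 = q1 by rewrite q1z -rmulA ap1.
have p1q1 : p1 ** q1 = q1 by rewrite -qs1 -ps1 -starM q1p1.
have Iq1 : I q1 by rewrite -p1q1; have [] := II q1 p1 I1.
have q10 : q1 != 0.
  by apply: contraNneq a0 => q10; rewrite -aq1 q10 rmulr0.
(* The link to p3 starts from the source q1 of a, so that its own source e lies below q1. *)
have [c [c0 p3c cq1]] := link _ _ Iq1 pq1 q10 pp3 n3.
have := range_iso c.
move=> [h3 [e [d [ph3 pe [h3c ce] [ed dh3] [cd dc [y3 h3y] [z3 ez]]]]]].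
have [ee es] := pe.
have eq1 : e ** q1 = e by rewrite ez -rmulA cq1.
have q1e : q1 ** e = e by rewrite -es -qs1 -starM eq1.
have p1e : p1 ** e = e by rewrite -q1e rmulA p1q1.
have e0 : e != 0 by apply: contraNneq c0 => e0; rewrite -ce e0 rmulr0.
(* Since b undoes a on e R, the source of a e is all of e, and its range h2 lies below p2. *)
have bae : b ** (a ** e) = e by rewrite rmulA ba q1e.
have [h2 [e' [b' [ph2 pe' [h2a ae'] [eb bh2] [ab' ba' [y2 h2y] [z2 e'z]]]]]] :=
  range_iso (a ** e).
have [ee' es'] := pe'.
have e'E : e' = e.
  have e'e : e' ** e = e' by rewrite e'z -!rmulA ee.
  have ee'' : e ** e' = e by rewrite -{1}bae -!rmulA [a ** _]rmulA ae' bae.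
  by rewrite -es' -e'e starM es es'.
rewrite e'E in ae' eb ba'.
have p2h2 : p2 ** h2 = h2.
  by rewrite h2y !rmulA p2a.
have p3h3 : p3 ** h3 = h3.
  by rewrite h3y !rmulA p3c.
have ep1 : e ** p1 = e by rewrite -es -ps1 -starM p1e.
have h2p2 : h2 ** p2 = h2.
  by have [_ s2] := pp2; have [_ hs] := ph2; rewrite -hs -s2 -starM p2h2.
exists e, h2, (a ** e), b', h3, c, d; split=> //.
- by split=> //; rewrite -p1e; have [] := II e p1 I1.
- by split=> //; rewrite -p2h2 -ep1 rmulA -[e ** p1 ** _]rmulA p12 rmulr0 rmul0r.
- by split=> //; rewrite -p3h3 -ep1 rmulA -[e ** p1 ** _]rmulA p13 rmulr0 rmul0r.
- by rewrite -p3h3 -h2p2 rmulA -[h2 ** p2 ** _]rmulA p23 rmulr0 rmul0r.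
Qed.

Lemma projection_sub (p e : R) : projection p -> projection e ->
  e ** p = p -> [/\ projection (e - p), e ** (e - p) = e - p,
    p ** (e - p) = 0 & p ** e = p].
Proof.
move=> [pp ps] [ee es] ep.
have pe : p ** e = p by rewrite -es -{1}ps -starM ep.
split=> //; last by rewrite rmulBr pe pp subrr.
  by split; [rewrite rmulBl !rmulBr ee ep pe pp subrr subr0 | rewrite starB es ps].
by rewrite rmulBr ee ep.
Qed.

Lemma sectional_rep_linear_rep : subdirectly_irreducible R ->
  has_faithful_sectional_MOL_rep (Lbar R) -> has_faithful_linear_rep R.
Proof.
move=> [I [idI [x Ix x0]] Imin] [D [V [B [iota [rep inj]]]]].
have [_ _ II] := idI.
have [e pe [ex [y ey] _]] := projection_range x.
have Ie : I e by rewrite ey; have [] := II y x Ix.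
have e0 : e != 0 by apply: contraNneq x0 => e0; rewrite -ex e0 rmul0r.
have [[p [pp Ip p0 pmin]]|nomin] := pselect (exists p : R,
    [/\ projection p, I p, p != 0 &
     forall q : R, projection q -> p ** q = q -> q = 0 \/ q = p]).
  apply: (@minimal_linear_rep R (MinimalProjection pp p0 pmin)).
  exact: (monolith_faithful Imin Ip).
have sub p : projection p -> I p -> p != 0 -> exists q : R,
    [/\ projection q, p ** q = q, q != 0 & q != p].
  move=> pp Ip p0; apply: contrapT => /forallNP noq; apply: nomin.
  exists p; split=> // q pq pqq; apply: contrapT => /not_orP[/eqP q0 /eqP qp].
  by apply: (noq q).
(* Without a minimal projection in I, two descents from e to f to g give the orthogonal nonzero
   projections g, f - g and e - f. *)
have [f [pf ef f0 fe]] := sub e pe Ie e0.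
have If : I f by rewrite -ef; have [] := II f e Ie.
have [g [pg fg g0 gf]] := sub f pf If f0.
have Ig : I g by rewrite -fg; have [] := II g f If.
have [pef _ fef _] := projection_sub pf pe ef.
have [pfg ffg gfg gf'] := projection_sub pg pf fg.
have [|||||k [h2 [t2 [t2' [h3 [t3 [t3' [pk [Ik k0] I2 I3 h23]]]]]]]] :=
    frame_exists Imin idI pg pfg pef Ig g0.
- by rewrite subr_eq0 eq_sym.
- by rewrite subr_eq0 eq_sym.
- by [].
- by rewrite -gf' -rmulA fef rmulr0.
- by rewrite rmulBl fef -gf' -rmulA fef rmulr0 subrr.
apply: (frame_linear_rep rep inj pk I2 I3 h23).
exact: (monolith_faithful Imin Ik).
Qed.

End SubdirectlyIrreducible.

(** * The unital case *)

Lemma scompl_ocompl (R : ustarRegType) (b x : Lbar R) : (x <= b)%O ->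
  scompl b x = (ocompl x `&` b)%O.
Proof.
move=> xb; have [bx xb'] := Lproj_le xb.
have [cc _] := projectionB xb.
have [bb _] := LprojP b; have [xx _] := LprojP x.
have oo : (rone - Lproj x) ** (rone - Lproj x) = rone - Lproj x.
  by rewrite rmulBr rmulr1 rmulBl rmul1r xx subrr subr0.
rewrite [in RHS](LprojE b); apply: Lbar_eq; apply/seteqP; split=> y.
  move=> /(mem_pideal _ cc) cy; split; apply/mem_pideal => //.
    by rewrite -cy rmulA rmulBl rmul1r rmulBr xb' xx subrr subr0.
  by rewrite -cy rmulA rmulBr bb bx.
move=> [/(mem_pideal _ oo) oy /(mem_pideal _ bb) by_]; apply/mem_pideal => //.
by rewrite rmulBl by_ -{1}[y]rmul1r -rmulBl.
Qed.

Theorem theorem3p31 :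
  (forall R : starRegType, subdirectly_irreducible R ->
     has_faithful_sectional_MOL_rep (Lbar R) -> has_faithful_linear_rep R) /\
  (forall R : ustarRegType, subdirectly_irreducible R ->
     has_faithful_MOL_rep (Lbar R) -> has_faithful_linear_rep R).
Proof.
split=> [|R si [D [V [B [iota [[hI hU h0 _ hC] inj]]]]]].
  exact: sectional_rep_linear_rep.
(* The same [iota] is a sectional representation, since sectional complements are meets with
   [ocompl x]. *)
apply: sectional_rep_linear_rep si _; exists D, V, B, iota; split=> //.
by split=> // b x /scompl_ocompl ->; rewrite hI hC.
Qed.
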